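(* For every integer $k\ge 2$ there exist constants $C_k,\tilde C_k\in(0,\infty)$, depending only on $k$, such that the following holds. Let $\{X_i\}$ be a sequence of independent random variables with values in a measurable space $({\cal S},S)$, let $\{X_i^{(j)}\}$, $j=1,\dots,k$, be $k$ independent copies of the sequence $\{X_i\}$, let $(B,\|\cdot\|)$ be a Banach space, let $n\ge k$, and let $f_{i_1i_2\dots i_k}$ (for pairwise distinct indices $i_1,\dots,i_k\in\{1,\dots,n\}$) be measurable functions from ${\cal S}\times\dots\times{\cal S}$ ($k$ factors) into $B$. (1) For all $t>0$, $$P\Big(\Big\|\sum_{1\le i_1\ne i_2\ne\dots\ne i_k\le n} f_{i_1\dots i_k}(X_{i_1}^{(1)},X_{i_2}^{(1)},\dots,X_{i_k}^{(1)})\Big\|\ge t\Big)\le C_k\,P\Big(C_k\Big\|\sum_{1\le i_1\ne i_2\ne\dots\ne i_k\le n} f_{i_1\dots i_k}(X_{i_1}^{(1)},X_{i_2}^{(2)},\dots,X_{i_k}^{(k)})\Big\|\ge t\Big).$$ (2) If in addition the symmetry condition $$f_{i_1i_2\dots i_k}(X_{i_1},X_{i_2},\dots,X_{i_k})=f_{i_{\pi(1)}i_{\pi(2)}\dots i_{\pi(k)}}(X_{i_{\pi(1)}},X_{i_{\pi(2)}},\dots,X_{i_{\pi(k)}})$$ holds almost surely for all permutations $\pi$ of $(1,\dots,k)$ (and all pairwise distinct $i_1,\dots,i_k\in\{1,\dots,n\}$), then for all $t>0$, $$P\Big(\Big\|\sum_{1\le i_1\ne i_2\ne\dots\ne i_k\le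 n} f_{i_1\dots i_k}(X_{i_1}^{(1)},X_{i_2}^{(2)},\dots,X_{i_k}^{(k)})\Big\|\ge t\Big)\le \tilde C_k\,P\Big(\tilde C_k\Big\|\sum_{1\le i_1\ne i_2\ne\dots\ne i_k\le n} f_{i_1\dots i_k}(X_{i_1}^{(1)},X_{i_2}^{(1)},\dots,X_{i_k}^{(1)})\Big\|\ge t\Big).$$
   Context: The notation $1\le i_1\ne i_2\ne\dots\ne i_k\le n$ means that $i_1,\dots,i_k$ range over $\{1,\dots,n\}$ and are all different (pairwise distinct), so the sums are over ordered $k$-tuples of pairwise distinct indices. ''$k$ independent copies of $\{X_i\}$'' means that the $k$ sequences $(X_i^{(j)})_i$, $j=1,\dots,k$, are mutually independent and each has the same joint distribution as $(X_i)_i$; the $X_i$ are not assumed identically distributed. Measurability of $f_{i_1\dots i_k}$ is understood as strong measurability with respect to the product $\sigma$-algebra (equivalently Borel measurability when $B$ is separable), so that all the sums above are $B$-valued random variables. *)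

(* Defs.v *)
From mathcomp Require Import all_boot all_order all_algebra all_fingroup.
From mathcomp Require Import all_classical all_reals all_analysis.

Set Implicit Arguments.
Unset Strict Implicit.
Unset Printing Implicit Defensive.

Import Order.TTheory GRing.Theory Num.Theory.
Import numFieldNormedType.Exports.

Local Open Scope classical_set_scope.
Local Open Scope ring_scope.

Definition mutually_independent (R : realType) d (Omega : measurableType d)
    (P : probability Omega R) d' (T : measurableType d') (I : eqType)
    (X : I -> Omega -> T) : Prop :=
  forall (J : seq I) (A : I -> set T),
    uniq J -> (forall i, i \in J -> measurable (A i)) ->
    P [set w | forall i, i \in J -> A i (X i w)] =
      (\prod_(i <- J) P (X i @^-1` A i))%E.

Definition same_distribution (R : realType) d (Omega : measurableType d)
    (P : probability Omega R) d' (T : measurableType d')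
    (X Y : Omega -> T) : Prop :=
  forall A : set T, measurable A -> P (X @^-1` A) = P (Y @^-1` A).

(* S^nat with the product sigma-algebra, generated by the coordinates. *)
Definition coordinate_sets d (S : measurableType d) : set (set (nat -> S)) :=
  [set E | exists i : nat, exists2 A : set S, measurable A &
             E = [set x | A (x i)]].

Notation seq_space S := (g_sigma_algebraType (@coordinate_sets _ S)).

Definition as_random_sequence (Omega : Type) d (S : measurableType d)
    (X : nat -> Omega -> S) : Omega -> seq_space S :=
  fun w i => X i w.

Definition independent_copies (R : realType) d (Omega : measurableType d)
    (P : probability Omega R) d' (S : measurableType d') (k : nat)
    (X : nat -> Omega -> S) (Y : 'I_k -> nat -> Omega -> S) : Prop :=
  mutually_independent P (fun j => as_random_sequence (Y j)) /\
  forall j, same_distribution P (as_random_sequence (Y j))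
                                (as_random_sequence X).

(* Limits of simple functions; {sfun _ >-> _} only covers real-valued ones. *)
Definition strongly_measurable (R : realType) (B : normedModType R)
    d (T : measurableType d) (f : T -> B) : Prop :=
  exists s : nat -> T -> B,
    (forall m, finite_set (range (s m)) /\
               forall y, measurable (s m @^-1` [set y])) /\
    forall x, s m x @[m --> \oo] --> f x.

(* The i_l of the mathematical notation range over 0, ..., n-1 here, and
   x l i is the value of the i-th variable of the l-th sequence. *)
Definition distinct_sum (B : zmodType) (S : Type) (n k : nat)
    (f : k.-tuple 'I_n -> k.-tuple S -> B) (x : 'I_k -> nat -> S) : B :=
  \sum_(i : k.-tuple 'I_n | uniq i) f i [tuple x l (tnth i l) | l < k].

(* Main.v *)
From HB Require Import structures.
Require Import Defs.
From mathcomp Require Import all_boot all_order all_algebra all_fingroup.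
From mathcomp Require Import all_classical all_reals all_analysis.
From mathcomp Require Import measurable_realfun ring lra zify.

Set Implicit Arguments.
Unset Strict Implicit.
Unset Printing Implicit Defensive.

Import Order.TTheory GRing.Theory Num.Theory.
Import numFieldNormedType.Exports.

Local Open Scope classical_set_scope.
Local Open Scope ring_scope.

(** Fix distinct letters, one for each copy of the sequence.  A word [w] of
    length [k] in these letters prescribes which copy feeds each argument of
    the kernels: it gives the random sum
      [D_w = sum over distinct i of f_i (X^(w_1)_(i_1), ..., X^(w_k)_(i_k))].
    The coupled sum is [D_w] for a constant word, the decoupled sum is [D_w]
    for a word without repeated letters, and [D] extends linearly to
    combinations [c] of words.  Say that [c] is dominated by [v] when
    [P (|D_c| >= t) <= C P (C |D_v| >= t)] with [C] depending on [c] and [v]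
    only, hence neither on the kernels nor on [n].  Everything follows from
    three closure properties of the combinations dominated by a given [v].

    They form a vector space ([dominatedD], [dominatedZ]).  They are stable
    under renaming of the letters ([dominated_renames]), because the copies are
    exchangeable.  The essential property is stability under averaging
    ([dominated_average]): apply to the letters a random permutation, drawn
    uniformly from a fixed finite family and independently at each index
    [i <= n].  For each outcome of the permutations the law of [D_c] is
    unchanged, since the copies may be permuted separately at each index.
    On the other hand, given the variables, [D_c] becomes a function of the
    [n] permutations which is a sum of functions of at most [k] of them, and
    its mean is [D] of the word combination in which every letter is replaced
    independently of the others; this uses that the indices of a summand are
    distinct.  Such a function has norm at least half the norm of its mean with
    a probability that is bounded below in terms of [k] and of the family alone
    ([norm_mean_le_often]), so the averaged combination is dominated by [c].

    The anticoncentration bound comes from hypercontractivity: the fourth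
    moment of a real sum of functions of [k] coordinates is bounded by the
    square of its second moment ([hypercontractivity]), so that such a sum keeps
    half of its second moment on any event [U] of probability close to one.
    Hence the Gram matrix of the functions of [k] coordinates, restricted to
    [U], is as nondegenerate as on the whole space, and solving a linear system
    writes the mean of every such function, vector-valued ones included, as a
    combination of its values on [U] with total weight at most the square root
    of two ([dual_weights]).  If the norm were below half the norm of the mean
    on all of [U], this would be contradictory.

    For part (1), words with more letters are treated first.  If a letter [a]
    is repeated in [w], replace one occurrence by a fresh letter [b] and average
    over the two ways of permuting [a] and [b].  The result is a combination of
    words with more letters, plus a multiple of [w + w_b], where [w_b] is [w]
    with [a] renamed into [b].  With a second fresh letter [c],
    [2 w = (w + w_b) + (w + w_c) - (w_b + w_c)], so [w] itself is dominated by a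
    word without repeated letters ([dominated_by_injective]).  The two fresh
    letters require one letter more than [k], so one more copy of the sequence
    is added on the product of the probability space with itself.

    For part (2), averaging a constant word over the transpositions that send
    its letter into a set [A] gives a multiple of the sum of all words in the
    letters of [A].  By induction on [A], the sum of the words in which exactly
    the letters of [A] occur is dominated by the constant word
    ([sum_words_with_dominated]).  When [A] consists of [k] letters these words
    are the permutations of the word of the decoupled sum, and under the
    symmetry condition they all give the same random sum almost surely
    ([decoupled_word_ae]). *)

(** * Functions on a finite product space *)

Section ProductSpace.
Variables (R : realFieldType) (I G : finType) (g0 : G).
Implicit Types (s : {ffun I -> G}) (u v p : {ffun I -> G} -> R) (A S : {set I}).

Definition depends_on (V : Type) S (h : {ffun I -> G} -> V) :=
  forall s s', {in S, s =1 s'} -> h s = h s'.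

Definition mean p : R := (\sum_s p s) / #|{ffun I -> G}|%:R.

Definition upd s x g : {ffun I -> G} := [ffun y => if y == x then g else s y].

Lemma card_gt0R : 0 < #|G|%:R :> R.
Proof. by rewrite ltr0n; apply/card_gt0P; exists g0. Qed.

Lemma card_ffun_gt0R : 0 < #|{ffun I -> G}|%:R :> R.
Proof. by rewrite ltr0n; apply/card_gt0P; exists [ffun=> g0]. Qed.

Lemma mean_ge0 p : (forall s, 0 <= p s) -> 0 <= mean p.
Proof. by move=> p0; rewrite divr_ge0 ?sumr_ge0. Qed.

Lemma ler_mean u v : (forall s, u s <= v s) -> mean u <= mean v.
Proof. by move=> uv; rewrite ler_wpM2r ?invr_ge0 ?ler0n// ler_sum. Qed.

Lemma eq_mean u v : (forall s, u s = v s) -> mean u = mean v.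
Proof. by move=> uv; rewrite /mean (eq_bigr v). Qed.

Lemma meanD u v : mean (fun s => u s + v s) = mean u + mean v.
Proof. by rewrite /mean big_split mulrDl. Qed.

Lemma meanZ c u : mean (fun s => c * u s) = c * mean u.
Proof. by rewrite /mean -mulr_sumr mulrA. Qed.

Lemma mean_sum (J : finType) (u : J -> {ffun I -> G} -> R) :
  mean (fun s => \sum_j u j s) = \sum_j mean (u j).
Proof. by rewrite /mean exchange_big mulr_suml. Qed.

Lemma mean_const c : mean (fun=> c) = c.
Proof.
by rewrite /mean sumr_const -[c *+ _]mulr_natr mulfK// gt_eqF ?card_ffun_gt0R.
Qed.

(** Resampling one coordinate preserves the uniform distribution: exchanging the
    value of [s] at [x] with the new value [g] is an involution of the pairs
    [(s, g)]. *)
Lemma mean_upd x p : mean p = (\sum_g mean (fun s => p (upd s x g))) / #|G|%:R.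
Proof.
rewrite /mean -mulr_suml mulrAC; congr (_ / _).
apply/esym/(canLR (mulfK _)); first by rewrite gt_eqF ?card_gt0R.
pose swap (z : {ffun I -> G} * G) := (upd z.1 x z.2, z.1 x).
have swapK : involutive swap.
  move=> [s g]; rewrite /swap /= ffunE eqxx; congr pair.
  by apply/ffunP => y; rewrite !ffunE; case: eqP => [->|].
transitivity (\sum_(z : {ffun I -> G} * G) p (swap z).1).
  by rewrite exchange_big pair_big.
transitivity (\sum_(z : {ffun I -> G} * G) p z.1).
  by rewrite [RHS](reindex_inj (inv_inj swapK)).
rewrite -(pair_big xpredT xpredT (fun s (g : G) => p s)) /= mulr_suml.
by apply: eq_bigr => s _; rewrite sumr_const mulr_natr.
Qed.

(** Cauchy-Schwarz, from the Lagrange identity. *)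
Lemma mean_cauchy u v :
  mean (fun s => u s * v s) ^+ 2 <=
  mean (fun s => u s ^+ 2) * mean (fun s => v s ^+ 2).
Proof.
rewrite /mean expr_div_n mulf_div -expr2.
apply: ler_wpM2r; first by rewrite invr_ge0 sqr_ge0.
set U := \sum_s u s ^+ 2; set V := \sum_s v s ^+ 2; set W := \sum_s u s * v s.
have : 0 <= \sum_s \sum_t (u s * v t - u t * v s) ^+ 2.
  by apply: sumr_ge0 => s _; apply: sumr_ge0 => t _; exact: sqr_ge0.
have -> : \sum_s \sum_t (u s * v t - u t * v s) ^+ 2 = 2 * (U * V - W ^+ 2).
  have -> : 2 * (U * V - W ^+ 2) = U * V + V * U - 2 * (W * W) by ring.
  rewrite /U /V /W !big_distrlr /= mulr_sumr -big_split -sumrB /=.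
  apply: eq_bigr => s _; rewrite mulr_sumr -big_split -sumrB /=.
  by apply: eq_bigr => t _; ring.
by rewrite pmulr_rge0 ?ltr0n// subr_ge0.
Qed.


Lemma depends_on_upd S x g (V : Type) (h : {ffun I -> G} -> V) :
  depends_on S h -> depends_on (S :\ x) (fun s => h (upd s x g)).
Proof.
move=> hS s s' ss'; apply: hS => y yS; rewrite !ffunE.
by case: eqP => // /eqP yx; apply: ss'; rewrite !inE yx.
Qed.

Lemma upd_notin S x g (V : Type) (h : {ffun I -> G} -> V) s :
  depends_on S h -> x \notin S -> h (upd s x g) = h s.
Proof.
move=> hS xS; apply: hS => y yS; rewrite ffunE; case: eqP => // yx.
by rewrite -yx yS in xS.
Qed.

(** Large enough for the induction step of [hypercontractivity], which needs
    [8 / hc_base <= 2] and [3 #|G| / hc_base ^+ 2 <= 1]. *)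
Definition hc_base : R := 4 * #|G|%:R.

(** The term [4 * q ^+ 3 * r] is left alone because it has mean zero where this
    is applied; the other odd term is absorbed by [4 q r^3 <= 2 q^2 r^2 + 2 r^4]. *)
Lemma quartic_le (q r : R) :
  (q + r) ^+ 4 <= q ^+ 4 + 4 * q ^+ 3 * r + 8 * (q ^+ 2 * r ^+ 2) + 3 * r ^+ 4.
Proof.
have : 0 <= (q * r - r ^+ 2) ^+ 2 by exact: sqr_ge0.
nra.
Qed.

(** Induction on the set [A] of coordinates on which the sum depends.  Split the
    sum as [q + r], where [q] is its average over one coordinate [x]; then [r]
    has mean zero in [x], and for each value of [x] it is a sum of functions of
    at most [k.-1] other coordinates, as the summands that do not depend on [x]
    cancel.  The gain of a factor [hc_base ^+ 2] in the bound for [r] pays for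
    the mixed terms. *)
Lemma hypercontractivity (J : finType) (k : nat) A (S : J -> {set I})
    (p : J -> {ffun I -> G} -> R) :
  (forall j, S j \subset A) -> (forall j, (#|S j| <= k)%N) ->
  (forall j, depends_on (S j) (p j)) ->
  mean (fun s => (\sum_j p j s) ^+ 4) <=
  hc_base ^+ (2 * k) * mean (fun s => (\sum_j p j s) ^+ 2) ^+ 2.
Proof.
have m_gt0 := card_gt0R; have m_ge1 : 1 <= #|G|%:R :> R.
  by rewrite ler1n -(ltr0n R).
have [n] := ubnP #|A|; elim: n => // n IHn in A k S p *; rewrite ltnS => leAn.
move=> SA Sk pS; have [A0|[x xA]] := finset.set_0Vmem A.
  have pc s : \sum_j p j s = \sum_j p j [ffun=> g0].
    apply: eq_bigr => j _; apply: pS => y yS.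
    by have := fintype.subsetP (SA j) y yS; rewrite A0 inE.
  under eq_mean do rewrite pc; rewrite mean_const.
  under [X in _ <= _ * X ^+ 2]eq_mean do rewrite pc; rewrite mean_const.
  rewrite -exprM ler_peMl ?exprn_even_ge0// exprn_ege1// /hc_base; lra.
have leA : (#|A :\ x| < n)%N by rewrite (cardsD1 x A) xA add1n in leAn.
case: k Sk => [|k] Sk.
  have S0 j : S j = finset.set0 by apply/eqP; rewrite -cards_eq0 -leqn0.
  by apply: (IHn (A :\ x) 0%N S p) => // j; rewrite S0 finset.sub0set.
pose P s := \sum_j p j s.
pose qj j s := (\sum_g p j (upd s x g)) / #|G|%:R.
pose q s := \sum_j qj j s.
pose rj g j s := if x \in S j then p j (upd s x g) - qj j s else 0.
pose r g s := \sum_j rj g j s.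
have qjS j : depends_on (S j :\ x) (qj j).
  move=> s s' ss'; congr (_ / _); apply: eq_bigr => g _.
  exact: depends_on_upd.
have qj_notin j s : x \notin S j -> qj j s = p j s.
  move=> xS; rewrite /qj; under eq_bigr do rewrite (upd_notin _ _ (pS j) xS).
  by rewrite sumr_const -[_ *+ #|_|]mulr_natr mulfK// gt_eqF.
have PE s g : P (upd s x g) = q s + r g s.
  rewrite /P /q /r -big_split; apply: eq_bigr => j _ /=; rewrite /rj.
  case: ifPn => xS; first by rewrite addrC subrK.
  by rewrite addr0 qj_notin// (upd_notin _ _ (pS j)).
have sum_r s : \sum_g r g s = 0.
  rewrite /r exchange_big big1// => j _; rewrite /rj.
  case: (x \in S j); last by rewrite big1.
  by rewrite sumrB sumr_const -[_ *+ #|_|]mulr_natr /qj divfK ?subrr// gt_eqF.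
have IHq : mean (fun s => q s ^+ 4) <=
    hc_base ^+ (2 * k.+1) * mean (fun s => q s ^+ 2) ^+ 2.
  apply: (IHn (A :\ x) k.+1 (fun j => S j :\ x) qj) => //.
  - by move=> j; exact: finset.setSD.
  - by move=> j; rewrite (leq_trans _ (Sk j))// subset_leq_card// finset.subsetDl.
have IHr g : mean (fun s => r g s ^+ 4) <=
    hc_base ^+ (2 * k) * mean (fun s => r g s ^+ 2) ^+ 2.
  apply: (IHn (A :\ x) k (fun j => if x \in S j then S j :\ x else finset.set0) (rj g)).
  - by [].
  - by move=> j; case: ifP => _; [exact: finset.setSD|exact: finset.sub0set].
  - move=> j; case: ifPn => [xS|]; last by rewrite cards0.
    by rewrite -ltnS (leq_trans _ (Sk j))// (cardsD1 x (S j)) xS.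
  - move=> j s s'; rewrite /rj; case: ifPn => // xS ss'.
    by rewrite (qjS j s s') // (depends_on_upd g (pS j) ss').
set Q := mean (fun s => q s ^+ 2) in IHq.
pose rho g := mean (fun s => r g s ^+ 2).
have Q0 : 0 <= Q by apply: mean_ge0 => s; exact: sqr_ge0.
have rho0 g : 0 <= rho g by apply: mean_ge0 => s; exact: sqr_ge0.
set D := hc_base; have D0 : 0 <= D by rewrite mulr_ge0 ?ltW.
(* Cauchy-Schwarz on the mixed term, with the induction hypotheses for both factors *)
have mixed g : mean (fun s => q s ^+ 2 * r g s ^+ 2) <= D ^+ (2 * k).+1 * (Q * rho g).
  rewrite -ler_sqr ?nnegrE; last 2 first.
  - by apply: mean_ge0 => s; rewrite mulr_ge0 ?sqr_ge0.
  - by apply: mulr_ge0; [exact: exprn_ge0|exact: mulr_ge0].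
  apply: le_trans (mean_cauchy _ _) _.
  under eq_mean do rewrite -exprM.
  under [X in _ * X]eq_mean do rewrite -exprM.
  apply: le_trans (ler_pM _ _ IHq (IHr g)) _.
  - by apply: mean_ge0 => s; rewrite exprn_even_ge0.
  - by apply: mean_ge0 => s; rewrite exprn_even_ge0.
  rewrite -/(rho g) -/D (_ : 2 * k.+1 = (2 * k).+2)%N; last by lia.
  by rewrite !(exprS D); rewrite le_eqVlt; apply/orP; left; apply/eqP; ring.
pose M := \sum_g rho g.
(* the orthogonality of q and r, which turns the second moment into a sum *)
have MP2 : mean (fun s => P s ^+ 2) = Q + M / #|G|%:R.
  rewrite (mean_upd x); under eq_bigr => g _.
    rewrite (_ : mean _ = Q + (2 * mean (fun s => q s * r g s) + rho g)); last first.
      rewrite -meanZ /Q /rho -!meanD; apply: eq_mean => s.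
      by rewrite PE; ring.
    over.
  rewrite big_split big_split /= sumr_const -mulr_sumr -mean_sum.
  under [mean _]eq_mean do rewrite -mulr_sumr sum_r mulr0.
  rewrite mean_const mulr0 add0r mulrDl -[_ *+ #|_|]mulr_natr mulfK//.
  by rewrite gt_eqF.
have MP4 : mean (fun s => P s ^+ 4) <= mean (fun s => q s ^+ 4) +
   (\sum_g (8 * mean (fun s => q s ^+ 2 * r g s ^+ 2)
             + 3 * mean (fun s => r g s ^+ 4))) / #|G|%:R.
  rewrite (mean_upd x).
  have -> : mean (fun s => q s ^+ 4) = (\sum_g (mean (fun s => q s ^+ 4) +
     mean (fun s => 4 * q s ^+ 3 * r g s))) / #|G|%:R.
    rewrite big_split /= -[X in _ + X]mean_sum.
    rewrite [X in _ + X](_ : _ = mean (fun=> 0)); last first.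
      by apply: eq_mean => s; rewrite -mulr_sumr sum_r mulr0.
    by rewrite mean_const addr0 sumr_const -[_ *+ #|_|]mulr_natr mulfK// gt_eqF.
  rewrite -mulrDl -big_split /=; apply: ler_wpM2r; first by rewrite invr_ge0 ltW.
  apply: ler_sum => g _; rewrite -!meanZ -!meanD.
  apply: ler_mean => s.
  by rewrite PE addrA; exact: quartic_le.
have M0 : 0 <= M by exact: sumr_ge0.
have rho2 : \sum_g rho g ^+ 2 <= M ^+ 2.
  rewrite expr2 {1}/M mulr_suml; apply: ler_sum => g _.
  rewrite expr2 ler_wpM2l//.
  by rewrite /M (bigD1 g)//= lerDl sumr_ge0.
rewrite -/P MP2; apply: le_trans MP4 _.
have -> : D ^+ (2 * k.+1) * (Q + M / #|G|%:R) ^+ 2 = D ^+ (2 * k.+1) * Q ^+ 2 +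
   D ^+ (2 * k) * D ^+ 2 * (2 * Q * M / #|G|%:R + M ^+ 2 / #|G|%:R ^+ 2).
  rewrite (_ : 2 * k.+1 = 2 * k + 2)%N; last by lia.
  by rewrite exprD; field; rewrite gt_eqF.
apply: lerD => //.
apply: (@le_trans _ _ ((\sum_g (8 * (D ^+ (2 * k).+1 * (Q * rho g)) +
    3 * (D ^+ (2 * k) * rho g ^+ 2))) / #|G|%:R)).
  apply: ler_wpM2r; first by rewrite invr_ge0 ltW.
  by apply: ler_sum => g _; apply: lerD; apply: ler_wpM2l.
rewrite big_split /= -!mulr_sumr -/M.
have E0 : 0 <= D ^+ (2 * k) by exact: exprn_ge0.
have QM : 0 <= Q * M by exact: mulr_ge0.
have SS0 : 0 <= \sum_g rho g ^+ 2 by apply: sumr_ge0 => g _; exact: sqr_ge0.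
rewrite exprS; move: (D ^+ (2 * k)) E0 => E E0; rewrite /D /hc_base.
move: (#|G|%:R : R) (Q) (M) (\sum_g rho g ^+ 2) m_gt0 m_ge1 QM M0 SS0 rho2.
move=> m Q' M' SS m_gt0 m_ge1 QM M0' SS0 rho2'.
have -> : (8 * (4 * m * E * (Q' * M')) + 3 * (E * SS)) / m =
  E * ((32 * m * (Q' * M') + 3 * SS) / m) by field; rewrite gt_eqF.
rewrite -[X in _ <= X]mulrA ler_wpM2l// ler_pdivrMr//.
have -> : (4 * m) ^+ 2 * (2 * Q' * M' / m + M' ^+ 2 / m ^+ 2) * m =
   32 * m ^+ 2 * (Q' * M') + 16 * m * M' ^+ 2 by field; rewrite gt_eqF.
apply: lerD; first by apply: ler_wpM2r => //; nra.
by apply: ler_pM => //; lra.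
Qed.


Lemma mean_sq_le u : mean u ^+ 2 <= mean (fun s => u s ^+ 2).
Proof.
have := mean_cauchy u (fun=> 1); rewrite (mean_const (1 ^+ 2)) expr1n mulr1.
by rewrite [in X in X -> _](eq_mean (v := u)) // => s; rewrite mulr1.
Qed.

(** By Cauchy-Schwarz the part of the second moment carried by the complement of
    [U] is at most the square root of the probability of that complement times
    the fourth moment, which hypercontractivity controls. *)
Lemma mean_sq_le_double_restrict (J : finType) k (S : J -> {set I})
    (p : J -> {ffun I -> G} -> R) (U : {set {ffun I -> G}}) :
  (forall j, (#|S j| <= k)%N) -> (forall j, depends_on (S j) (p j)) ->
  #|~: U|%:R * (4 * hc_base ^+ (2 * k)) <= #|{ffun I -> G}|%:R ->
  mean (fun s => (\sum_j p j s) ^+ 2) <=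
  2 * mean (fun s => (s \in U)%:R * (\sum_j p j s) ^+ 2).
Proof.
move=> Sk pS smallU; pose P s := \sum_j p j s.
have hP : mean (fun s => P s ^+ 4) <=
    hc_base ^+ (2 * k) * mean (fun s => P s ^+ 2) ^+ 2.
  by apply: (@hypercontractivity J k [set: I] S p) => // j; exact: subsetT.
set E := mean (fun s => P s ^+ 2) in hP *.
set EU := mean (fun s => (s \in U)%:R * P s ^+ 2).
pose EC := mean (fun s => (s \in ~: U)%:R * P s ^+ 2).
have N0 := card_ffun_gt0R.
have E0 : 0 <= E by apply: mean_ge0 => s; exact: sqr_ge0.
have EC0 : 0 <= EC by apply: mean_ge0 => s; rewrite mulr_ge0 ?sqr_ge0.
have EE : E = EU + EC.
  rewrite -meanD; apply: eq_mean => s; rewrite inE.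
  by case: (s \in U); rewrite ?mul1r ?mul0r ?addr0 ?add0r.
have EC2 : EC ^+ 2 <= (#|~: U|%:R / #|{ffun I -> G}|%:R) *
    (hc_base ^+ (2 * k) * E ^+ 2).
  apply: le_trans (mean_cauchy _ _) _.
  have -> : mean (fun s => (s \in ~: U)%:R ^+ 2) = #|~: U|%:R / #|{ffun I -> G}|%:R.
    congr (_ / _); rewrite -sum1_card natr_sum [RHS]big_mkcond.
    by apply: eq_bigr => s _; case: ifP; rewrite ?expr1n ?expr0n.
  apply: ler_wpM2l; first by rewrite divr_ge0.
  by rewrite [X in X <= _](eq_mean (v := fun s => P s ^+ 4)) // => s; rewrite -exprM.
have EC4 : EC ^+ 2 <= E ^+ 2 / 4.
  apply: le_trans EC2 _; rewrite [leRHS]mulrC mulrA; apply: ler_wpM2r.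
    exact: sqr_ge0.
  by rewrite mulrAC ler_pdivrMr// mulrC ler_pdivlMl// mulrA mulrC.
have EC2' : EC <= E / 2.
  have E20 : 0 <= E / 2 by lra.
  suff : EC ^+ 2 <= (E / 2) ^+ 2 by rewrite ler_sqr.
  lra.
lra.
Qed.

(** The weights are [q = 1_U * p], with [p] a combination of the [phi j]; the
    required identities form a linear system whose matrix is the Gram matrix of
    the [phi j] on [U].  It is solvable: if a combination is in the kernel of
    the Gram matrix, its second moment on [U] vanishes, hence so does its mean.
    Pairing the solution with itself bounds its second moment on [U]. *)
Lemma dual_weights (J : finType) k (S : J -> {set I})
    (phi : J -> {ffun I -> G} -> R) (U : {set {ffun I -> G}}) :
  (forall j, (#|S j| <= k)%N) -> (forall j, depends_on (S j) (phi j)) ->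
  #|~: U|%:R * (4 * hc_base ^+ (2 * k)) <= #|{ffun I -> G}|%:R ->
  exists q : {ffun I -> G} -> R,
  [/\ forall j, \sum_s q s * phi j s = mean (phi j),
      forall s, s \notin U -> q s = 0 &
      (\sum_s `|q s|) ^+ 2 <= 2].
Proof.
move=> Sk phiS smallU; have N0 := card_ffun_gt0R.
pose comb (z : 'I_#|J| -> R) s := \sum_b z b * phi (enum_val b) s.
have combP z : mean (fun s => comb z s ^+ 2) <=
    2 * mean (fun s => (s \in U)%:R * comb z s ^+ 2).
  apply: (@mean_sq_le_double_restrict _ k (fun b => S (enum_val b))) => //.
  by move=> j s s' ss'; rewrite (phiS _ s s').
pose A := \matrix_(a < #|J|, b < #|J|)
  \sum_s (s \in U)%:R * (phi (enum_val a) s * phi (enum_val b) s).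
pose e := \row_(b < #|J|) mean (phi (enum_val b)).
have mean_comb z : mean (comb z) = \sum_b e 0 b * z b.
  rewrite mean_sum; apply: eq_bigr => b _.
  by rewrite meanZ mxE mulrC.
have AE z b : \sum_a z a * A a b =
    \sum_s (s \in U)%:R * (comb z s * phi (enum_val b) s).
  under eq_bigr do rewrite mxE mulr_sumr.
  rewrite exchange_big; apply: eq_bigr => s _ /=.
  rewrite mulr_suml mulr_sumr; apply: eq_bigr => a _; ring.
have quadE z : \sum_b (\sum_a z a * A a b) * z b =
    \sum_s (s \in U)%:R * comb z s ^+ 2.
  under eq_bigr do rewrite AE mulr_suml.
  rewrite exchange_big; apply: eq_bigr => s _ /=.
  rewrite expr2 {3}/comb !mulr_sumr; apply: eq_bigr => b _; ring.
have Asym a b : A a b = A b a.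
  by rewrite !mxE; apply: eq_bigr => s _; rewrite [phi _ _ * _]mulrC.
(* e is in the row space of A as soon as it annihilates the kernel of A *)
have /submxP[y ey] : (e <= A)%MS.
  rewrite submxE; apply/eqP/rowP => c; rewrite !mxE.
  pose z b := cokermx A b c; rewrite -(mean_comb z).
  have Az b : \sum_a z a * A a b = 0.
    have /matrixP/(_ b c) := mulmx_coker A; rewrite [LHS]mxE [RHS]mxE => AK.
    by rewrite -[RHS]AK; apply: eq_bigr => a _; rewrite mulrC Asym.
  suff m2 : mean (comb z) ^+ 2 <= 0.
    by apply/eqP; rewrite -sqrf_eq0 eq_le m2 sqr_ge0.
  apply: le_trans (mean_sq_le _) _; apply: le_trans (combP z) _.
  rewrite /mean -quadE big1 => [|b _]; first by rewrite mul0r mulr0.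
  by rewrite Az mul0r.
pose z b := y 0 b; pose q s := (s \in U)%:R * comb z s.
have eE b : e 0 b = \sum_a z a * A a b by rewrite ey mxE.
exists q; split.
- move=> j; have := eE (enum_rank j); rewrite AE mxE enum_rankK => ->.
  by apply: eq_bigr => s _; rewrite /q mulrA.
- by move=> s /negPf sU; rewrite /q sU mul0r.
pose s2 := \sum_s (s \in U)%:R * comb z s ^+ 2.
have s20 : 0 <= s2 by apply: sumr_ge0 => s _; rewrite mulr_ge0 ?sqr_ge0.
have s2E : s2 = mean (comb z).
  by rewrite mean_comb /s2 -quadE; apply: eq_bigr => b _; rewrite eE.
(* s2 is both the second moment of the solution on U and its mean *)
have s2le : s2 ^+ 2 <= 2 * (s2 / #|{ffun I -> G}|%:R).
  by rewrite {1}s2E; apply: le_trans (mean_sq_le _) (combP z).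
have s2N : s2 * #|{ffun I -> G}|%:R <= 2.
  have [->|s2neq0] := eqVneq s2 0; first by rewrite mul0r.
  have s2gt0 : 0 < s2 by rewrite lt_def s2neq0.
  move: s2le; rewrite expr2 mulrCA ler_pM2l// => s2le.
  by rewrite -ler_pdivlMr.
apply: le_trans s2N.
have := mean_sq_le (fun s => `|q s|).
have -> : mean (fun s => `|q s| ^+ 2) = s2 / #|{ffun I -> G}|%:R.
  congr (_ / _); apply: eq_bigr => s _.
  rewrite real_normK ?num_real// /q exprMn.
  by case: (s \in U); rewrite ?expr1n ?expr0n.
rewrite /mean expr_div_n ler_pdivrMr ?exprn_gt0// expr2 mulrA.
by rewrite divfK// gt_eqF.
Qed.

End ProductSpace.

Section VectorValued.
Variables (R : realType) (V : normedModType R) (I G : finType) (g0 : G).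

(** Anticoncentration in a normed space: if the norm were less than half the norm
    of the mean outside a small exceptional set, the representation of the mean
    given by [dual_weights] would make the mean smaller than itself, as the
    weights have total mass at most the square root of two.  The mean is passed
    as a vector [v] to spare its computation as a quotient. *)
Lemma norm_mean_le_often (J : finType) k (S : J -> {set I})
    (h : J -> {ffun I -> G} -> V) (v : V) :
  (forall j, (#|S j| <= k)%N) -> (forall j, depends_on (S j) (h j)) ->
  #|{ffun I -> G}|%:R *: v = \sum_s \sum_j h j s ->
  #|{ffun I -> G}|%:R <=
  #|[pred s | `|v| <= 2 * `|\sum_j h j s| ]|%:R * (4 * hc_base R G ^+ (2 * k)).
Proof.
move=> Sk hS vE; have N0 := card_ffun_gt0R R I g0.
pose U : {set {ffun I -> G}} := [set s | 2 * `|\sum_j h j s| < `|v| ]%SET.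
have -> : #|[pred s | `|v| <= 2 * `|\sum_j h j s| ]| = #|~: U|.
  by apply: eq_card => s; rewrite !inE -leNgt.
rewrite leNgt; apply/negP => smallU'; have smallU := ltW smallU'.
(* Replacing the coordinates outside S j by g0 keeps h j unchanged and leaves
   finitely many values, so h j is a combination of the real indicators phi. *)
pose res (A : {set I}) (s : {ffun I -> G}) : {ffun I -> G} :=
  [ffun x => if x \in A then s x else g0].
pose phi (z : J * {ffun I -> G}) s : R := (res (S z.1) s == z.2)%:R.
have [||q [qphi q0 q2]] := @dual_weights R I G g0 _ k (fun z => S z.1) phi U _ _ smallU.
- by move=> [].
- move=> [j t] s s' ss'; rewrite /phi /=; congr (_ == _)%:R.
  by apply/ffunP => x; rewrite !ffunE; case: ifP => // /ss'.
have hE j s : h j s = \sum_t phi (j, t) s *: h j t.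
  rewrite (bigD1 (res (S j) s)) //= /phi /= eqxx scale1r big1 ?addr0.
    by apply: hS => x xS; rewrite ffunE xS.
  by move=> t /negPf ts; rewrite eq_sym ts scale0r.
have vq : v = \sum_s q s *: \sum_j h j s.
  apply: (@scalerI _ _ #|{ffun I -> G}|%:R); first by rewrite gt_eqF.
  rewrite vE exchange_big scaler_sumr /=.
  under [RHS]eq_bigr do rewrite scaler_sumr scaler_sumr.
  rewrite [RHS]exchange_big; apply: eq_bigr => j _ /=.
  under eq_bigr do rewrite hE.
  under [RHS]eq_bigr do rewrite hE scaler_sumr scaler_sumr.
  rewrite exchange_big [RHS]exchange_big; apply: eq_bigr => t _ /=.
  under [RHS]eq_bigr do rewrite !scalerA -mulrA.
  rewrite -!scaler_suml -mulr_sumr (qphi (j, t)) /mean mulrC divfK ?gt_eqF//.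
have [v0|v0] := eqVneq v 0.
  have U0 : ~: U = [set: _]%SET.
    by apply/setP => s; rewrite !inE v0 normr0 -leNgt mulr_ge0.
  move: smallU'; rewrite U0 cardsT ltNge ler_peMr ?ltW//.
  have m1 : 1 <= #|G|%:R :> R by rewrite ler1n; apply/card_gt0P; exists g0.
  have D1 : 1 <= hc_base R G by rewrite /hc_base; lra.
  by have := exprn_ege1 (2 * k) D1; lra.
have nv : 0 < `|v| by rewrite normr_gt0.
have : `|v| <= (\sum_s `|q s|) * (`|v| / 2).
  rewrite {1}vq (le_trans (ler_norm_sum _ _ _))// mulr_suml ler_sum// => s _.
  rewrite normrZ; have [sU|sU] := boolP (s \in U); last by rewrite q0 // normr0 !mul0r.
  by move: sU; rewrite inE => sU; apply: ler_wpM2l => //; lra.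
rewrite mulrCA -[leLHS]mulr1 ler_pM2l// ler_pdivlMr// mul1r => q2'.
have : 2 ^+ 2 <= (\sum_s `|q s|) ^+ 2 by rewrite ler_sqr ?nnegrE// sumr_ge0.
by move=> /le_trans /(_ q2); lra.
Qed.

End VectorValued.

(** * Domination between combinations of words *)

Section Counting.
Context d (Omega : measurableType d) (R : realType) (P : probability Omega R).

(** Markov's inequality for the number of events that occur. *)
Lemma measure_le_of_often (F : finType) (E : set Omega) (A : F -> set Omega)
    (N kappa : R) :
  measurable E -> (forall s, measurable (A s)) -> 0 <= N -> 0 <= kappa ->
  (forall w, E w -> N <= #|[pred s | w \in A s]|%:R * kappa) ->
  (N%:E * P E <= kappa%:E * \sum_s P (A s))%E.
Proof.
move=> mE mA N0 kappa0 often.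
have mind (B : set Omega) : measurable B ->
    measurable_fun [set: Omega] (fun w => (\1_B w)%:E : \bar R).
  by move=> mB; apply/measurable_EFinP; exact: measurable_indic.
have ind0 (B : set Omega) w : (0 <= (\1_B w)%:E :> \bar R)%E by rewrite lee_fin.
have PI (B : set Omega) : measurable B -> P B = (\int[P]_w (\1_B w)%:E)%E.
  by move=> mB; rewrite integral_indic// setIT.
rewrite PI// (eq_bigr (fun s => \int[P]_w (\1_(A s) w)%:E)%E); last first.
  by move=> s _; exact: PI.
rewrite -ge0_integral_sum//; last by move=> s; exact: mind.
rewrite -!ge0_integralZl_EFin//; last 3 first.
- by move=> w _; exact: sume_ge0.
- by apply: emeasurable_sum => s; exact: mind.
- exact: mind.
apply: ge0_le_integral => //.
- by move=> w _; rewrite mule_ge0// lee_fin.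
- by apply: measurable_funeM; exact: mind.
- by apply: measurable_funeM; apply: emeasurable_sum => s; exact: mind.
move=> w _; rewrite sumEFin -!EFinM lee_fin.
have -> : \sum_s \1_(A s) w = #|[pred s | w \in A s]|%:R :> R.
  rewrite -sum1_card natr_sum [RHS]big_mkcond; apply: eq_bigr => s _.
  by rewrite indicE inE; case: (w \in A s).
rewrite indicE; case: (boolP (w \in E)) => [|_]; last by rewrite mulr0 mulr_ge0.
by rewrite inE mulr1 mulrC => /often.
Qed.

End Counting.

Section Letters.
Variables (R : realType) (k K : nat).
Notation word := {ffun 'I_k -> 'I_K}.
Implicit Types (c v : {ffun word -> R}) (w : word).

(** [sigma] permutes the copies separately at each index [x < n]; [relabel] is
    its effect on the word read at the indices [i]. *)
Definition relabel n (sigma : 'I_n -> 'S_K) (i : k.-tuple 'I_n) w : word :=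
  [ffun l => sigma (tnth i l) (w l)].

(** The random sum attached to the combination [c] of words, after the copies
    have been permuted by [sigma].  The value [a i w] stands for the kernel of
    index [i], evaluated at the copies prescribed by the word [w]. *)
Definition comb (Omega : Type) (B : lmodType R) n
    (a : k.-tuple 'I_n -> word -> Omega -> B) c (sigma : 'I_n -> 'S_K) o : B :=
  \sum_(i : k.-tuple 'I_n | uniq i) \sum_w c w *: a i (relabel sigma i w) o.

Notation noswap := (fun=> 1%g).

Lemma relabel1 n (i : k.-tuple 'I_n) w : relabel noswap i w = w.
Proof. by apply/ffunP => l; rewrite ffunE perm1. Qed.

Definition tail d (Omega : measurableType d) (P : probability Omega R)
    (B : normedModType R) n (a : k.-tuple 'I_n -> word -> Omega -> B) c
    (sigma : 'I_n -> 'S_K) (t : R) : \bar R :=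
  P [set o | t <= `|comb a c sigma o| ].

(** What is used of the independence of the copies: permuting them at each index
    does not change the laws of the norms. *)
Record exchangeable d (Omega : measurableType d) (P : probability Omega R)
    (B : normedModType R) n (a : k.-tuple 'I_n -> word -> Omega -> B) := {
  exch_measurable : forall c sigma t,
    measurable [set o | t <= `|comb a c sigma o| ];
  exch_invariant : forall c sigma t,
    tail P a c sigma t = tail P a c noswap t }.

(** The constant is chosen before the probability space, the normed space, the
    number [n] of indices and the array. *)
Definition dominated c v := exists2 C : R, 0 < C &
  forall d (Omega : measurableType d) (P : probability Omega R)
    (B : normedModType R) n (a : k.-tuple 'I_n -> word -> Omega -> B),
  exchangeable P a -> forall t, 0 < t ->
  (tail P a c noswap t <=
   C%:E * tail P a v noswap (t / C))%E.

Lemma dominated_refl v : dominated v v.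
Proof. by exists 1 => // d O P B n a _ t _; rewrite mul1e divr1. Qed.

Lemma dominated_trans v c e : dominated e c -> dominated c v -> dominated e v.
Proof.
move=> [C C0 ec] [C' C'0 cv]; exists (C * C') => [|d O P B n a ha t t0].
  exact: mulr_gt0.
apply: le_trans (ec _ _ _ _ _ _ ha _ t0) _.
rewrite EFinM -muleA lee_pmul2l ?lte_fin//.
rewrite invfM mulrA; apply: cv => //; exact: divr_gt0.
Qed.

Lemma tail_antitone d (Omega : measurableType d) (P : probability Omega R)
    (B : normedModType R) n (a : k.-tuple 'I_n -> word -> Omega -> B) v s t :
  exchangeable P a -> s <= t ->
  (tail P a v noswap t <= tail P a v noswap s)%E.
Proof.
move=> ha st; apply: le_measure; rewrite ?inE.
- exact: (exch_measurable ha).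
- exact: (exch_measurable ha).
- by move=> o; exact: le_trans.
Qed.

(** The constants inside and outside the probability may be taken different. *)
Lemma dominated_intro c v (p q : R) : 0 < p -> 0 < q ->
  (forall d (Omega : measurableType d) (P : probability Omega R)
    (B : normedModType R) n (a : k.-tuple 'I_n -> word -> Omega -> B),
  exchangeable P a -> forall t, 0 < t ->
  (tail P a c noswap t <=
   p%:E * tail P a v noswap (t / q))%E) -> dominated c v.
Proof.
move=> p0 q0 cv; exists (p + q) => [|d O P B n a ha t t0]; first exact: addr_gt0.
apply: le_trans (cv _ _ _ _ _ _ ha _ t0) _.
apply: lee_pmul => //; rewrite ?lee_fin; first exact: ltW.
  by rewrite lerDl ltW.
apply: (tail_antitone _ ha); rewrite ler_pM2l// lef_pV2 ?posrE ?addr_gt0//.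
by rewrite lerDr ltW.
Qed.

Lemma combD Omega (B : lmodType R) n (a : k.-tuple 'I_n -> word -> Omega -> B)
    c e sigma o :
  comb a (c + e) sigma o = comb a c sigma o + comb a e sigma o.
Proof.
rewrite -big_split; apply: eq_bigr => i _; rewrite -big_split.
by apply: eq_bigr => w _; rewrite ffunE scalerDl.
Qed.

Lemma combZ Omega (B : lmodType R) n (a : k.-tuple 'I_n -> word -> Omega -> B)
    r c sigma o :
  comb a (r *: c) sigma o = r *: comb a c sigma o.
Proof.
rewrite scaler_sumr; apply: eq_bigr => i _; rewrite scaler_sumr.
by apply: eq_bigr => w _; rewrite ffunE scalerA.
Qed.

Lemma comb0 Omega (B : lmodType R) n (a : k.-tuple 'I_n -> word -> Omega -> B)
    sigma o : comb a 0 sigma o = 0.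
Proof. by rewrite -(scale0r 0) combZ scale0r. Qed.

Lemma dominated0 v : dominated 0 v.
Proof.
exists 1 => // d O P B n a ha t t0; rewrite /tail (_ : [set o | _] = set0) ?measure0.
  by rewrite mule_ge0.
by apply/seteqP; split=> // o /=; rewrite comb0 normr0 leNgt t0.
Qed.

(** One of two vectors is at least half as large as their sum. *)
Lemma dominatedD v c e : dominated c v -> dominated e v -> dominated (c + e) v.
Proof.
move=> [p p0 cv] [q q0 ev].
apply: (@dominated_intro _ _ (p + q) (2 * (p + q))); rewrite ?mulr_gt0 ?addr_gt0//.
move=> d O P B n a ha t t0; have t20 : 0 < t / 2 by rewrite divr_gt0.
have ctail := exch_measurable ha.
apply: (@le_trans _ _ (P ([set o | t / 2 <= `|comb a c noswap o| ] `|`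
    [set o | t / 2 <= `|comb a e noswap o| ]))).
  apply: le_measure; rewrite ?inE//; first exact: measurableU.
  move=> o /=; rewrite combD => tce.
  have [cs|cs] := leP (t / 2) `|comb a c noswap o|; first by left.
  by right => /=; have := ler_normD (comb a c noswap o) (comb a e noswap o); lra.
apply: le_trans (measureU2 _ _ _) _ => //.
rewrite EFinD ge0_muleDl ?lee_fin ?(ltW p0) ?(ltW q0)//.
apply: leeD.
- apply: le_trans (cv _ _ _ _ _ _ ha _ t20) _; rewrite lee_pmul2l ?lte_fin//.
  apply: (tail_antitone _ ha); rewrite invfM mulrA ler_pM2l//.
  by rewrite lef_pV2 ?posrE ?addr_gt0// lerDl ltW.
- apply: le_trans (ev _ _ _ _ _ _ ha _ t20) _; rewrite lee_pmul2l ?lte_fin//.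
  apply: (tail_antitone _ ha); rewrite invfM mulrA ler_pM2l//.
  by rewrite lef_pV2 ?posrE ?addr_gt0// lerDr ltW.
Qed.

Lemma dominatedZ r v c : dominated c v -> dominated (r *: c) v.
Proof.
move=> cv; have [->|r0] := eqVneq r 0; first by rewrite scale0r; exact: dominated0.
apply: dominated_trans cv; apply: (@dominated_intro _ _ 1 `|r|) => //.
  by rewrite normr_gt0.
move=> d O P B n a ha t t0; rewrite mul1e le_eqVlt; apply/orP; left; apply/eqP.
congr (P _); apply/seteqP; split=> o /=;
  by rewrite combZ normrZ ler_pdivrMr ?normr_gt0// mulrC.
Qed.

Lemma dominated_sum (J : finType) (Q : pred J) v (c : J -> {ffun word -> R}) :
  (forall j, Q j -> dominated (c j) v) -> dominated (\sum_(j | Q j) c j) v.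
Proof.
move=> cv; apply: (big_ind (fun c => dominated c v)) => //.
  exact: dominated0.
by move=> c1 c2; exact: dominatedD.
Qed.

Definition single w : {ffun word -> R} := [ffun w' => (w' == w)%:R].

Lemma comb_single Omega (B : lmodType R) n
    (a : k.-tuple 'I_n -> word -> Omega -> B) w sigma o :
  comb a (single w) sigma o = \sum_(i : k.-tuple 'I_n | uniq i) a i (relabel sigma i w) o.
Proof.
apply: eq_bigr => i _; rewrite (bigD1 w)//= ffunE eqxx scale1r big1 ?addr0//.
by move=> w' /negPf ww'; rewrite ffunE ww' scale0r.
Qed.

Lemma sum_single c : c = \sum_w c w *: single w.
Proof.
apply/ffunP => w; rewrite sum_ffunE (bigD1 w)//= !ffunE eqxx /GRing.scale /= mulr1.
rewrite big1 ?addr0//.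
by move=> w' /negPf ww'; rewrite !ffunE eq_sym ww' /GRing.scale /= mulr0.
Qed.

Definition rename (pi : 'S_K) w : word := [ffun l => pi (w l)].

Lemma renameK (pi : 'S_K) : cancel (rename pi) (rename pi^-1).
Proof. by move=> w; apply/ffunP => l; rewrite !ffunE permK. Qed.

Lemma renameVK (pi : 'S_K) : cancel (rename pi^-1) (rename pi).
Proof. by move=> w; apply/ffunP => l; rewrite !ffunE permKV. Qed.

Definition renames (pi : 'S_K) c : {ffun word -> R} := [ffun w => c (rename pi^-1 w)].

Lemma renamesD pi c e : renames pi (c + e) = renames pi c + renames pi e.
Proof. by apply/ffunP => w; rewrite !ffunE. Qed.

Lemma renames_single pi w : renames pi (single w) = single (rename pi w).
Proof.
by apply/ffunP => w'; rewrite !ffunE (can2_eq (@renameVK pi) (@renameK pi)).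
Qed.

Lemma dominated_renames (pi : 'S_K) c v : dominated c v -> dominated (renames pi c) v.
Proof.
apply: dominated_trans; apply: (@dominated_intro _ _ 1 1) => //.
move=> d O P B n a ha t t0; rewrite mul1e divr1.
rewrite -(exch_invariant ha c (fun=> pi)) le_eqVlt; apply/orP; left; apply/eqP.
suff E o : comb a (renames pi c) noswap o = comb a c (fun=> pi) o.
  by congr (P _); apply/seteqP; split=> o /=; rewrite E.
apply: eq_bigr => i _; rewrite (reindex (rename pi)) /=; last first.
  by exists (rename pi^-1) => w _; rewrite ?renameK ?renameVK.
by apply: eq_bigr => w _; rewrite relabel1 ffunE renameK.
Qed.

Section Averaging.
Variables (G : finType) (g0 : G) (tau : G -> 'S_K).

(** The probability that the letter [x] becomes [y] under a permutation drawn
    uniformly from the family [tau]. *)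
Definition transition x y : R := (\sum_g (tau g x == y)%:R) / #|G|%:R.

(** In each word, every letter is replaced independently of the others. *)
Definition average c : {ffun word -> R} :=
  [ffun w' : word => \sum_w c w * \prod_l transition (w l) (w' l)].

(** The permutations used at distinct indices are independent, so the letters of
    the relabelled word are independent. *)
Lemma relabel_equidistributed n (i : k.-tuple 'I_n) w w' : uniq i ->
  \sum_(s : {ffun 'I_n -> G}) (relabel (tau \o s) i w == w')%:R =
  #|{ffun 'I_n -> G}|%:R * \prod_l transition (w l) (w' l).
Proof.
move=> ui; have m0 := card_gt0R R g0.
pose F x g : R := \prod_(l | tnth i l == x) (tau g (w l) == w' l)%:R.
transitivity (\sum_(s : {ffun 'I_n -> G}) \prod_x F x (s x)).
  apply: eq_bigr => s _.
  transitivity (\prod_l (tau (s (tnth i l)) (w l) == w' l)%:R : R).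
    have [/eqP ww'|ww'] := boolP (relabel (tau \o s) i w == w').
      by rewrite big1// => l _; rewrite -ww' ffunE eqxx.
    have [l lw] : exists l, relabel (tau \o s) i w l != w' l.
      by apply/existsP; apply: contraNT ww' => /existsPn ww'; apply/eqP/ffunP => l;
         apply/eqP; move: (ww' l); rewrite negbK.
    by rewrite (bigD1 l)//=; move: lw; rewrite ffunE /= => /negPf ->; rewrite mul0r.
  rewrite (partition_big (tnth i) xpredT)//=; apply: eq_bigr => x _.
  by apply: eq_bigr => l /eqP ->.
rewrite -(bigA_distr_bigA (fun x g => F x g)) /=.
have -> : #|{ffun 'I_n -> G}|%:R = \prod_(x < n) #|G|%:R :> R.
  by rewrite card_ffun card_ord natrX prodr_const card_ord.
rewrite [in RHS](partition_big (tnth i) xpredT)//= -big_split /=.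
apply: eq_bigr => x _; rewrite /F.
have [/tnthP[l xl]|xi] := boolP (x \in i).
  have il l' : (tnth i l' == x) = (l' == l).
    by rewrite xl; apply/eqP/eqP => [/(tuple_uniqP _ ui)|->].
  rewrite (eq_bigl _ _ il) big_pred1_eq mulrC divfK ?gt_eqF//.
  by apply: eq_bigr => g _; rewrite (eq_bigl _ _ il) big_pred1_eq.
have il l' : (tnth i l' == x) = false.
  by apply: contraNF xi => /eqP <-; exact: mem_tnth.
under eq_bigr do rewrite (eq_bigl _ _ il) big_pred0_eq.
by rewrite (eq_bigl _ _ il) big_pred0_eq sumr_const mulr1.
Qed.

(** Linearity of the mean and [relabel_equidistributed], index by index. *)
Lemma comb_average Omega (B : lmodType R) n
    (a : k.-tuple 'I_n -> word -> Omega -> B) c o :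
  #|{ffun 'I_n -> G}|%:R *: comb a (average c) noswap o =
  \sum_(s : {ffun 'I_n -> G}) comb a c (tau \o s) o.
Proof.
rewrite exchange_big scaler_sumr; apply: eq_bigr => i ui /=.
rewrite exchange_big /=.
transitivity (\sum_w \sum_(w' : word) (c w * (#|{ffun 'I_n -> G}|%:R *
    \prod_l transition (w l) (w' l))) *: a i w' o).
  rewrite scaler_sumr exchange_big; apply: eq_bigr => w' _ /=.
  rewrite relabel1 ffunE scaler_suml scaler_sumr; apply: eq_bigr => w _.
  by rewrite scalerA mulrCA.
apply: eq_bigr => w _; rewrite -scaler_sumr.
under eq_bigr do rewrite -(relabel_equidistributed _ _ ui) -scalerA scaler_suml.
rewrite -scaler_sumr exchange_big; congr (_ *: _); apply: eq_bigr => s _ /=.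
rewrite (bigD1 (relabel (tau \o s) i w))//= eqxx scale1r big1 ?addr0//.
by move=> w' /negPf ww'; rewrite eq_sym ww' scale0r.
Qed.

(** For each outcome of the variables, anticoncentration shows that a fixed
    proportion of the choices of permutations gives a sum at least half as large
    as the averaged one; by exchangeability all these choices have the same
    tail. *)
Lemma dominated_average c v : dominated c v -> dominated (average c) v.
Proof.
apply: dominated_trans; pose kappa := 4 * hc_base R G ^+ (2 * k).
have m0 := card_gt0R R g0.
have kappa0 : 0 < kappa by rewrite mulr_gt0 ?exprn_gt0// mulr_gt0.
apply: (@dominated_intro _ _ kappa 2) => // d O P B n a ha t t0.
have N0 := card_ffun_gt0R R 'I_n g0; set N := #|{ffun 'I_n -> G}|%:R : R in N0 *.
have : (N%:E * tail P a (average c) noswap t <= kappa%:E *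
    \sum_(s : {ffun 'I_n -> G}) tail P a c (tau \o s) (t / 2))%E.
  apply: measure_le_of_often; rewrite ?ltW//.
  - exact: (exch_measurable ha).
  - by move=> s; exact: (exch_measurable ha).
  move=> o /= to.
  pose h (i : k.-tuple 'I_n) (s : {ffun 'I_n -> G}) : B :=
    if uniq i then \sum_w c w *: a i (relabel (tau \o s) i w) o else 0.
  have hE (s : {ffun 'I_n -> G}) : comb a c (tau \o s) o = \sum_i h i s.
    by rewrite /comb big_mkcond.
  have := @norm_mean_le_often R B 'I_n G g0 _ k (fun i : k.-tuple 'I_n => [set x in i]%SET) h
    (comb a (average c) noswap o).
  rewrite comb_average => /(_ _ _ _)/le_trans; apply.
  - by move=> i; rewrite cardsE (leq_trans (card_size _)) ?size_tuple.
  - move=> i s s' ss'; rewrite /h; case: ifP => // _; apply: eq_bigr => w _.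
    congr (_ *: a i _ o); apply/ffunP => l; rewrite !ffunE /= ss'//.
    by rewrite inE mem_tnth.
  - by apply: eq_bigr => s _.
  rewrite ler_wpM2r ?(ltW kappa0)// ler_nat subset_leq_card//.
  apply/fintype.subsetP => s; rewrite !inE -hE => nle; have {nle} := le_trans to nle.
  by rewrite /= ler_pdivrMr// mulrC.
under eq_bigr do rewrite (exch_invariant ha) -[tail _ _ _ _ _]mul1e.
rewrite -ge0_sume_distrl// sumEFin sumr_const -/N muleCA lee_pmul2l ?lte_fin//.
Qed.

End Averaging.
End Letters.

(** * Words dominated by a word with distinct letters, or by a constant word *)

Section Words.
Variables (R : realType) (k K : nat).
Notation word := {ffun 'I_k -> 'I_K}.
Implicit Types (c : {ffun word -> R}) (w : word).
Notation single := (@single R k K).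

Definition letters w : {set 'I_K} := (w @: [set: 'I_k])%SET.

Lemma mem_letters w l : w l \in letters w.
Proof. by apply: imset_f; rewrite inE. Qed.

Lemma lettersP w x : reflect (exists l, x = w l) (x \in letters w).
Proof.
by apply: (iffP imsetP) => [[l _ ->]|[l ->]]; exists l.
Qed.

(** Each transposition of the letters [v l] and [w l] makes one more position
    agree. *)
Lemma injective_rename (w v : word) : injective w -> injective v ->
  exists pi, rename pi v = w.
Proof.
move=> wi; have [m] := ubnP #|[set l | v l != w l]%SET|.
elim: m => // m IHm in v *; rewrite ltnS => vm vi.
have [l /= vl|vw] := pickP [pred l | v l != w l]; last first.
  by exists 1%g; apply/ffunP => l; rewrite ffunE perm1; apply/eqP; move: (vw l) => /= /negbFE.
pose v' := rename (tperm (v l) (w l)) v.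
have [||pi pw] := IHm v'; last 1 first.
- exists (tperm (v l) (w l) * pi)%g; rewrite -[RHS]pw.
  by apply/ffunP => l'; rewrite /v' !ffunE permM.
- apply: leq_trans vm; apply: proper_card; apply/properP; split.
    apply/fintype.subsetP => l'; rewrite !inE !ffunE; apply: contra => /eqP vw'.
    rewrite tpermD ?vw'//; last first.
      by apply: contraNneq vl => /wi ->; rewrite vw'.
    by rewrite -vw'; apply: contraNneq vl => /vi ->; rewrite vw'.
  by exists l; rewrite !inE// !ffunE tpermL eqxx.
- by move=> l1 l2; rewrite !ffunE => /perm_inj /vi.
Qed.

Lemma dominated_single_rename pi w (v : {ffun word -> R}) :
  dominated (single w) v -> dominated (single (rename pi w)) v.
Proof. by rewrite -renames_single; exact: dominated_renames. Qed.

Definition swap (a b : 'I_K) (g : bool) : 'S_K := if g then tperm a b else 1%g.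

Lemma average_single (G : finType) (tau : G -> 'S_K) w :
  average (R := R) tau (single w) =
  \sum_(w' : word) (\prod_l transition R tau (w l) (w' l)) *: single w'.
Proof.
rewrite [LHS]sum_single; apply: eq_bigr => w' _; congr (_ *: _).
rewrite ffunE (bigD1 w)//= ffunE eqxx mul1r [X in _ + X]big1 => [|v /negPf vw].
  by rewrite addr0.
by rewrite ffunE vw mul0r.
Qed.

Lemma transition_swap a b x y :
  transition R (swap a b) x y = ((tperm a b x == y)%:R + (x == y)%:R) / 2.
Proof. by rewrite /transition card_bool big_bool /= perm1. Qed.

(** The reduction of a word [w] in which the letter [a] is repeated to words with
    more letters.  Averaging over [a] and [b] the word [u], obtained from [w] by
    changing one occurrence of [a] into a fresh letter [b], gives all the words
    in which each [a] of [w] is kept or changed into [b].  The only ones without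
    a new letter added to those of [w] are [w] itself and its renaming [wb], and
    they have the same coefficient.  A second fresh letter separates [w] from
    [wb]. *)
Lemma repeated_letter_dominated (v : {ffun word -> R}) w l1 l2 :
  (k < K)%N -> l1 != l2 -> w l1 = w l2 ->
  (forall w', (#|letters w| < #|letters w'|)%N -> dominated (single w') v) ->
  dominated (single w) v.
Proof.
move=> kK l12 w12 IH; pose a := w l1.
(* the repetition leaves two letters unused *)
have : (1 < #|~: letters w|)%N.
  have : (#|letters w| < k)%N.
    have -> : letters w = (w @: [set~ l2])%SET.
      apply/setP => x; apply/idP/imsetP => [/lettersP[l ->]|[l _ ->]]; last first.
        exact: mem_letters.
      have [->|ll2] := eqVneq l l2; first by exists l1; rewrite ?inE.
      by exists l; rewrite ?inE.
    apply: leq_ltn_trans (leq_imset_card _ _) _.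
    by rewrite cardsC1 card_ord ltn_predL (leq_ltn_trans _ (ltn_ord l1)).
  have := cardsC (letters w); rewrite card_ord; lia.
case/card_gt1P => b [c' [bw cw bc]].
rewrite !inE in bw cw.
have aw : a \in letters w := mem_letters w l1.
have ab : a != b by apply: contraNneq bw => <-.
have ac : a != c' by apply: contraNneq cw => <-.
have wb_neq l : w l != b by apply: contraNneq bw => <-; exact: mem_letters.
have wc_neq l : w l != c' by apply: contraNneq cw => <-; exact: mem_letters.
pose u : word := [ffun l => if l == l1 then b else w l].
pose wb := rename (tperm a b) w.
(* words that agree with w off the occurrences of a and use both a and b *)
have card_more w' : a \in letters w' -> b \in letters w' ->
    (forall l, w l != a -> w' l = w l) -> dominated (single w') v.
  move=> aw' bw' ww'; apply: IH.
  have := cardsU1 b (letters w); rewrite bw add1n => <-.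
  apply: subset_leq_card; apply/fintype.subsetP => x.
  rewrite in_setU1 => /predU1P[->//|/lettersP[l ->]].
  have [->//|wla] := eqVneq (w l) a.
  by rewrite -ww'//; exact: mem_letters.
have domu : dominated (single u) v.
  apply: card_more.
  - by apply/lettersP; exists l2; rewrite ffunE eq_sym (negPf l12) -w12.
  - by apply/lettersP; exists l1; rewrite ffunE eqxx.
  - by move=> l wl; rewrite ffunE; case: (eqVneq l l1) wl => [->|//]; rewrite eqxx.
have := dominated_average true (swap a b) domu.
rewrite average_single; pose theta w' := \prod_l transition R (swap a b) (u l) (w' l).
have thetab : theta wb = theta w.
  apply: eq_bigr => l _; rewrite !transition_swap.
  have -> : wb l = tperm a b (w l) by rewrite ffunE.
  rewrite (inj_eq perm_inj) addrC.
  congr ((_%:R + _) / _); congr (nat_of_bool _).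
  by apply/eqP/eqP => [->|<-]; rewrite tpermK.
have theta0 : theta w != 0.
  have half (x y : bool) : x || y -> (x%:R + y%:R) / 2 != 0 :> R.
    by case: x; case: y => // _;
      rewrite mulf_neq0 ?invr_eq0 -?natrD ?addr0 ?add0r ?pnatr_eq0.
  apply/prodf_neq0 => l _; rewrite transition_swap; apply: half; rewrite ffunE.
  by case: (eqVneq l l1) => [->|_]; rewrite ?tpermR ?eqxx ?orbT.
have theta_supp w' l : theta w' != 0 -> w' l = tperm a b (u l) \/ w' l = u l.
  move=> /prodf_neq0/(_ l isT); rewrite transition_swap.
  case: (eqVneq (tperm a b (u l)) (w' l)) => [->|_]; first by left.
  by case: (eqVneq (u l) (w' l)) => [->|_]; [right|rewrite addr0 mul0r eqxx].
have wwb : wb != w.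
  by apply/eqP => /ffunP/(_ l1); rewrite ffunE tpermL; apply/eqP; rewrite eq_sym.
rewrite (bigD1 w)//= (bigD1 wb)//= -/(theta w) -/(theta wb) thetab addrA -scalerDr.
have rest : dominated (\sum_(w' | (w' != w) && (w' != wb)) theta w' *: single w') v.
  apply: dominated_sum => w' /andP[w'w w'wb].
  have [->|tw'] := eqVneq (theta w') 0; first by rewrite scale0r; exact: dominated0.
  apply: dominatedZ.
  have other l : w l != a -> w' l = w l.
    move=> wla; have ul : u l = w l.
      by rewrite ffunE; case: (eqVneq l l1) wla => [->|//]; rewrite eqxx.
    by case: (theta_supp w' l tw') => ->; rewrite ul// tpermD// eq_sym// wb_neq.
  have onA l : w l = a -> w' l = a \/ w' l = b.
    move=> wla; have [ul|ul] : u l = a \/ u l = b.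
    - by rewrite ffunE; case: ifP; [right|left].
    - by case: (theta_supp w' l tw') => ->; rewrite ul ?tpermL; [right|left].
    - by case: (theta_supp w' l tw') => ->; rewrite ul ?tpermR; [left|right].
  apply: card_more => //.
  - apply: contraNT w'wb => aw'; apply/eqP/ffunP => l; rewrite ffunE.
    have [wla|wla] := eqVneq (w l) a; last by rewrite other// tpermD// eq_sym.
    rewrite wla tpermL; case: (onA _ wla) => // w'a.
    by rewrite -w'a mem_letters in aw'.
  - apply: contraNT w'w => bw'; apply/eqP/ffunP => l.
    have [wla|wla] := eqVneq (w l) a; last by rewrite other.
    rewrite wla; case: (onA _ wla) => // w'b.
    by rewrite -w'b mem_letters in bw'.
move=> avg; have pair_ab : dominated (single w + single wb) v.
  rewrite -[_ + _](scalerK theta0); apply: dominatedZ.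
  rewrite -[_ *: _](addrK (\sum_(w' | (w' != w) && (w' != wb)) theta w' *: single w')).
  by apply: dominatedD => //; rewrite -scaleN1r; exact: dominatedZ.
pose wc := rename (tperm a c') w.
have pair_ac : dominated (single w + single wc) v.
  have := dominated_renames (tperm b c') pair_ab; rewrite renamesD !renames_single.
  have -> : rename (tperm b c') w = w.
    by apply/ffunP => l; rewrite ffunE tpermD// eq_sym.
  suff -> : rename (tperm b c') wb = wc by [].
  apply/ffunP => l; rewrite !ffunE; have [->|wla] := eqVneq (w l) a.
    by rewrite !tpermL.
  by rewrite !tpermD// ?[a == _]eq_sym// ?[b == _]eq_sym// ?[c' == _]eq_sym// tpermD// eq_sym.
have pair_bc : dominated (single wc + single wb) v.
  have := dominated_renames (tperm a c') pair_ab; rewrite renamesD !renames_single.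
  suff -> : rename (tperm a c') wb = wb by [].
  apply/ffunP => l; rewrite !ffunE; have [->|wla] := eqVneq (w l) a.
    by rewrite !tpermL tpermD// eq_sym.
  by rewrite [tperm a b _]tpermD// ?tpermD// eq_sym.
have -> : single w = 2^-1 *: ((single w + single wb) + (single w + single wc)
    + (-1) *: (single wc + single wb)).
  by apply/ffunP => w'; rewrite !ffunE /GRing.scale /=; field.
by apply: dominatedZ; apply: dominatedD; [exact: dominatedD|exact: dominatedZ].
Qed.

(** Induction on the number of letters not used by [w]. *)
Lemma dominated_by_injective w w0 : (k < K)%N -> injective w0 ->
  dominated (single w) (single w0).
Proof.
move=> kK w0i; have [m] := ubnP (K - #|letters w|)%N.
elim: m => // m IHm in w *; rewrite ltnS => wm.
have [/injectiveP wi|/injectivePn[l1 [l2 l12 w12]]] := boolP (injectiveb w).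
  have [pi <-] := injective_rename wi w0i.
  by apply: dominated_single_rename; exact: dominated_refl.
apply: (repeated_letter_dominated kK l12 w12) => w' ww'.
have : (#|letters w'| <= K)%N by rewrite -[X in (_ <= X)%N]card_ord max_card.
by move=> lw'; apply: IHm; lia.
Qed.

Definition const_word x : word := [ffun=> x].

(** For [y] in [A], the transpositions of [y] with the elements of [A] make the
    image of [y] uniform in [A]; averaging the constant word [y] thus gives all
    the words in the letters of [A], with equal coefficients. *)
Lemma sum_words_over_dominated x0 (A : {set 'I_K}) : (0 < k)%N ->
  dominated (\sum_(w | letters w \subset A) single w) (single (const_word x0)).
Proof.
move=> k0; have [->|[y yA]] := set_0Vmem A.
  rewrite big_pred0; first exact: dominated0.
  move=> w; rewrite finset.subset0; apply/negP => /eqP w0.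
  by have := mem_letters w (Ordinal k0); rewrite w0 inE.
have domy : dominated (single (const_word y)) (single (const_word x0)).
  have -> : const_word y = rename (tperm x0 y) (const_word x0).
    by apply/ffunP => l; rewrite !ffunE tpermL.
  by apply: dominated_single_rename; exact: dominated_refl.
pose tau (g : {x | x \in A}) := tperm y (val g).
have trE x : transition R tau y x = (x \in A)%:R / #|A|%:R.
  rewrite /transition card_sig; congr (_ / _).
  have [xA|xA] := boolP (x \in A).
    rewrite (bigD1 (exist _ x xA))//= tpermL eqxx big1 ?addr0// => g gx.
    rewrite tpermL; case: eqP => // gx'.
    by move: gx; rewrite -val_eqE /= gx' eqxx.
  rewrite big1// => g _; rewrite tpermL; case: eqP => // gx.
  by move: xA; rewrite -gx (valP g).
have := dominated_average (exist _ y yA) tau domy.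
rewrite average_single.
have A0 : #|A|%:R != 0 :> R.
  by rewrite pnatr_eq0 -lt0n; apply/card_gt0P; exists y.
have -> : \sum_(w | letters w \subset A) single w =
    #|A|%:R ^+ k *: \sum_(w : word)
      (\prod_l transition R tau (const_word y l) (w l)) *: single w.
  rewrite scaler_sumr big_mkcond; apply: eq_bigr => w _; rewrite scalerA.
  under eq_bigr do rewrite ffunE trE.
  rewrite big_split /= prodr_const card_ord mulrCA -exprMn divff// expr1n mulr1.
  case: ifPn => [/fintype.subsetP wA|/subsetPn[x /lettersP[l ->] wA]].
    rewrite big1 ?scale1r// => l _.
    by rewrite wA// mem_letters.
  by rewrite (bigD1 l)//= (negPf wA) mul0r scale0r.
exact: dominatedZ.
Qed.

(** Subtract from the sum over all the words in the letters of [A] the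
    contributions of the proper subsets of [A]. *)
Lemma sum_words_with_dominated x0 (A : {set 'I_K}) : (0 < k)%N ->
  dominated (\sum_(w | letters w == A) single w) (single (const_word x0)).
Proof.
move=> k0; have [m] := ubnP #|A|; elim: m => // m IHm in A *; rewrite ltnS => Am.
have := sum_words_over_dominated x0 A k0.
rewrite (partition_big letters (fun A' : {set 'I_K} => A' \subset A))//=.
rewrite (bigD1 A)//= => dA.
rewrite (eq_bigl (fun w => (letters w \subset A) && (letters w == A))); last first.
  by move=> w; case: eqP => [->|]; rewrite ?subxx ?andbF.
rewrite -[X in dominated X](addrK (\sum_(A' : {set 'I_K} | (A' \subset A) && (A' != A))
   \sum_(w | (letters w \subset A) && (letters w == A')) single w)).
apply: dominatedD => //; rewrite -scaleN1r; apply: dominatedZ.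
apply: dominated_sum => A' /andP[A'A A'neq].
rewrite (eq_bigl (fun w => letters w == A')); last first.
  by move=> w; case: eqP => [->|]; rewrite ?A'A ?andbF.
apply: IHm; apply: leq_trans Am; apply: proper_card.
by rewrite finset.properEneq A'neq.
Qed.

End Words.

(** * Strong measurability *)

Section StrongMeasurability.
Context (R : realType) (B : normedModType R).

(** The approximating functions in the definition of strong measurability. *)
Definition simple d (T : measurableType d) (s : T -> B) :=
  finite_set (range s) /\ forall y, measurable (s @^-1` [set y]).

Lemma simple_preimage d (T : measurableType d) (s : T -> B) (U : set B) :
  simple s -> measurable (s @^-1` U).
Proof.
move=> [fs ms].
have -> : s @^-1` U = \bigcup_(y in range s `&` U) s @^-1` [set y].
  apply/seteqP; split=> [x Ux|x [y [_ Uy] /= ->]//].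
  by exists (s x) => //; split=> //; exists x.
apply: fin_bigcup_measurable => //.
by apply: sub_finite_set fs; exact: subIsetl.
Qed.

Lemma strongly_measurable_comp d d' (T : measurableType d) (T' : measurableType d')
    (f : T' -> B) (h : T -> T') :
  strongly_measurable f -> measurable_fun [set: T] h -> strongly_measurable (f \o h).
Proof.
move=> [s [ss cvs]] mh; exists (fun m => s m \o h); split=> [m|x]; last exact: cvs.
have [fs ms] := ss m; split.
  by apply: sub_finite_set fs => _ [x _ <-]; exists (h x).
by move=> y; rewrite -[X in measurable X]setTI comp_preimage; exact: mh.
Qed.

Lemma strongly_measurableD d (T : measurableType d) (f g : T -> B) :
  strongly_measurable f -> strongly_measurable g ->
  strongly_measurable (f \+ g).
Proof.
move=> [s [ss cvs]] [r [rr cvr]]; exists (fun m => s m \+ r m); split=> [m|x]; last first.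
  by apply: cvgD; [exact: cvs|exact: cvr].
have [fs ms] := ss m; have [fr mr] := rr m; split.
  apply: sub_finite_set (finite_image2 +%R fs fr) => _ [x _ <-].
  by exists (s m x); [exists x|exists (r m x); [exists x|]].
move=> y; have -> : (s m \+ r m) @^-1` [set y] =
    \bigcup_(z in range (s m)) (s m @^-1` [set z] `&` r m @^-1` [set y - z]).
  apply/seteqP; split=> [x /= <-|x [z _ [/= <- ->]]]; last by rewrite addrC subrK.
  by exists (s m x); [exists x|split=> //=; rewrite [s m x + _]addrC addrK].
by apply: fin_bigcup_measurable => // z _; exact: measurableI.
Qed.

Lemma strongly_measurableZ d (T : measurableType d) (c : R) (f : T -> B) :
  strongly_measurable f -> strongly_measurable (fun x => c *: f x).
Proof.
move=> [s [ss cvs]]; exists (fun m x => c *: s m x); split=> [m|x]; last first.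
  by apply: cvgZr; exact: cvs.
split; last by move=> y; exact: (simple_preimage [set z | c *: z = y] (ss m)).
apply: sub_finite_set (finite_image (fun z => c *: z) (ss m).1) => _ [x _ <-].
by exists (s m x) => //; exists x.
Qed.

Lemma strongly_measurable0 d (T : measurableType d) :
  strongly_measurable (fun _ : T => 0 : B).
Proof.
exists (fun _ _ => 0); split=> [m|x]; last exact: cvg_cst.
split; first by apply: sub_finite_set (finite_set1 0) => _ [x _ <-].
move=> y; have [<-|y0] := pselect (0 = y).
  by rewrite (_ : _ @^-1` _ = setT)//; apply/seteqP; split.
by rewrite (_ : _ @^-1` _ = set0)//; apply/seteqP; split.
Qed.

Lemma strongly_measurable_sum d (T : measurableType d) (J : finType) (Q : pred J)
    (f : J -> T -> B) :
  (forall j, Q j -> strongly_measurable (f j)) ->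
  strongly_measurable (fun x => \sum_(j | Q j) f j x).
Proof.
move=> mf; rewrite (_ : (fun x => _) = \sum_(j | Q j) f j); last first.
  by apply/funext => x; rewrite fct_sumE.
apply: (big_ind (fun h : T -> B => strongly_measurable h)) => //.
- exact: strongly_measurable0.
- exact: strongly_measurableD.
Qed.

Lemma measurable_norm_strongly d (T : measurableType d) (f : T -> B) :
  strongly_measurable f -> measurable_fun [set: T] (fun x => `|f x|).
Proof.
move=> [s [ss cvs]].
apply: (@measurable_fun_cvg _ _ _ _ (fun m x => `|s m x|)) => [m|x _].
  move=> _ Y _; rewrite setTI; exact: (simple_preimage [set z | Y `|z| ] (ss m)).
by apply: cvg_norm; exact: cvs.
Qed.

Lemma measurable_norm_ge d (T : measurableType d) (f : T -> B) (t : R) :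
  strongly_measurable f -> measurable [set x | t <= `|f x| ].
Proof.
move=> /measurable_norm_strongly mf.
have := mf measurableT _ (measurable_itv `[t, +oo[); rewrite setTI.
by congr measurable; apply/seteqP; split=> x /=; rewrite in_itv /= andbT.
Qed.

End StrongMeasurability.

(** * The joint law of finitely many variables *)

Section Configurations.
Context (I : finType) d (S : measurableType d).

(** Generating the product sigma-algebra from full rectangles rather than from
    coordinates provides a generating class stable under intersection. *)
Definition rectangles : set (set (I -> S)) :=
  [set E | exists2 A : I -> set S, (forall i, measurable (A i)) &
             E = [set x | forall i, A i (x i)]].

Definition cfg : Type := g_sigma_algebraType rectangles.
HB.instance Definition _ := Measurable.on cfg.

Lemma measurable_coord (i : I) : measurable_fun [set: cfg] (fun x : cfg => x i).
Proof.
move=> _ A mA; rewrite setTI; apply: sub_sigma_algebra.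
exists (fun j => if j == i then A else setT) => [j|]; first by case: eqP.
apply/seteqP; split=> [x Ax j|x /(_ i)]; last by rewrite eqxx.
by case: eqP => [->|].
Qed.

Lemma measurable_cfg d' (T : measurableType d') (Z : I -> T -> S) :
  (forall i, measurable_fun [set: T] (Z i)) ->
  measurable_fun [set: T] ((fun o i => Z i o) : T -> cfg).
Proof.
move=> mZ; apply: (@measurability _ _ _ cfg _ _ rectangles) => // _ [E [A mA ->] <-].
rewrite setTI (_ : _ @^-1` _ = \bigcap_(i in [set: I]) (Z i @^-1` A i)); last first.
  by apply/seteqP; split=> [x /= Ax i _|x Ax i /=]; exact: Ax.
apply: fin_bigcap_measurable => // i _.
by rewrite -[X in measurable X]setTI; exact: mZ.
Qed.

(** Two finite measures that agree on a generating class stable under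
    intersection are equal. *)
Lemma law_unique d' (T : measurableType d') (R : realType) (P : probability T R)
    (Z W : I -> T -> S) :
  (forall i, measurable_fun [set: T] (Z i)) ->
  (forall i, measurable_fun [set: T] (W i)) ->
  (forall A : I -> set S, (forall i, measurable (A i)) ->
     P [set o | forall i, A i (Z i o)] = P [set o | forall i, A i (W i o)]) ->
  forall E : set cfg, measurable E ->
    P [set o | E (fun i => Z i o)] = P [set o | E (fun i => W i o)].
Proof.
move=> mZ mW ZW E mE.
pose z : {mfun T >-> cfg} := mfun_Sub (mem_set (measurable_cfg mZ)).
pose w : {mfun T >-> cfg} := mfun_Sub (mem_set (measurable_cfg mW)).
apply: (@measure_unique _ R cfg rectangles (fun=> setT) _ _ _ _
  (pushforward P z) (pushforward P w)) => //.
- move=> _ _ [A mA ->] [A' mA' ->]; exists (fun i => A i `&` A' i).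
    by move=> i; exact: measurableI.
  apply/seteqP; split=> [x [Ax Ax'] i|x Ax]; first by split.
  by split=> i; have [] := Ax i.
- by move=> _; exists (fun=> setT) => //; apply/seteqP; split.
- by apply/seteqP; split => // x _; exists 0%N.
- by move=> _ [A mA ->]; exact: ZW.
- by move=> _; change (P setT < +oo)%E; rewrite probability_setT ltry.
Qed.

End Configurations.

(** * Arrays built from independent copies *)

Section IndependentRows.
Context (R : realType) d (Omega : measurableType d) (P : probability Omega R).
Context d' (S : measurableType d').

(** The variables [Z a i] are independent and the law of [Z a i] is [mu i],
    whatever the copy [a]. *)
Definition independent_rows n K (Z : 'I_K -> nat -> Omega -> S)
    (mu : nat -> set S -> \bar R) :=
  (forall a i, measurable_fun [set: Omega] (Z a i)) /\
  forall A : 'I_K -> 'I_n -> set S, (forall a i, measurable (A a i)) ->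
    P [set o | forall a i, A a i (Z a i o)] =
    (\prod_a \prod_(i < n) mu i (A a i))%E.

(** The probability of a rectangle is a product over the indices, in which each
    factor is symmetric in the copies. *)
Lemma independent_rows_permute n K (Z : 'I_K -> nat -> Omega -> S) mu
    (sigma : 'I_n -> 'S_K) (E : set (cfg ('I_K * 'I_n)%type S)) :
  independent_rows n Z mu -> measurable E ->
  P [set o | E (fun p => Z (sigma p.2 p.1) p.2 o)] =
  P [set o | E (fun p => Z p.1 p.2 o)].
Proof.
move=> [mZ lawZ] mE; apply: (@law_unique ('I_K * 'I_n)%type) => // A mA.
pose A' a i := A ((sigma i)^-1%g a, i).
have -> : [set o | forall p, A p (Z (sigma p.2 p.1) p.2 o)] =
          [set o | forall a i, A' a i (Z a i o)].
  apply/seteqP; split=> [z Ao a i|z Ao [a i] /=].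
    by have := Ao ((sigma i)^-1%g a, i); rewrite /= permKV.
  by have := Ao (sigma i a) i; rewrite /A' permK.
have -> : [set o | forall p, A p (Z p.1 p.2 o)] =
          [set o | forall a i, A (a, i) (Z a i o)].
  by apply/seteqP; split=> [z Ao a i|z Ao [a i]]; [exact: (Ao (a, i))|exact: Ao].
rewrite (lawZ A') ?(lawZ (fun a i => A (a, i)))// => [|a i]; last exact: mA.
rewrite exchange_big [RHS]exchange_big; apply: eq_bigr => i _ /=.
rewrite (reindex_inj (@perm_inj _ (sigma i))); apply: eq_bigr => a _.
by rewrite /A' permK.
Qed.

Definition letter_array (B : Type) n k K (f : k.-tuple 'I_n -> k.-tuple S -> B)
    (Z : 'I_K -> nat -> Omega -> S) (i : k.-tuple 'I_n) (w : {ffun 'I_k -> 'I_K}) o : B :=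
  f i [tuple Z (w l) (tnth i l) o | l < k].

Lemma exchangeable_letter_array (B : normedModType R) n k K
    (f : k.-tuple 'I_n -> k.-tuple S -> B) (Z : 'I_K -> nat -> Omega -> S) mu :
  independent_rows n Z mu ->
  (forall i : k.-tuple 'I_n, uniq i -> strongly_measurable (f i)) ->
  exchangeable P (letter_array f Z).
Proof.
move=> rowsZ mf; have [mZ _] := rowsZ.
pose D c (x : cfg ('I_K * 'I_n)%type S) := \sum_(i : k.-tuple 'I_n | uniq i)
  \sum_(w : {ffun 'I_k -> 'I_K}) c w *: f i [tuple x (w l, tnth i l) | l < k].
have mD (c : {ffun {ffun 'I_k -> 'I_K} -> R}) t : measurable [set x | t <= `|D c x| ].
  apply: measurable_norm_ge; apply: strongly_measurable_sum => i ui.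
  apply: strongly_measurable_sum => w _; apply: strongly_measurableZ.
  apply: (strongly_measurable_comp (mf i ui)); apply/measurable_fun_tnthP => l.
  rewrite (_ : _ \o _ = fun x : cfg _ _ => x (w l, tnth i l)); first exact: measurable_coord.
  by apply/funext => x /=; rewrite tnth_mktuple.
have DE (c : {ffun {ffun 'I_k -> 'I_K} -> R}) (sigma : 'I_n -> 'S_K) o :
    comb (letter_array f Z) c sigma o = D c (fun p => Z (sigma p.2 p.1) p.2 o).
  apply: eq_bigr => i _; apply: eq_bigr => w _; congr (_ *: f i _).
  by apply: eq_from_tnth => l; rewrite !tnth_mktuple ffunE.
have tailE c s t : [set o | t <= `|comb (letter_array f Z) c s o| ] =
    [set o | [set x | t <= `|D c x| ] (fun p : 'I_K * 'I_n => Z (s p.2 p.1) p.2 o)].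
  by apply/seteqP; split=> o /=; rewrite DE.
split=> c sigma t.
- have := measurable_cfg (I := ('I_K * 'I_n)%type)
    (fun p => mZ (sigma p.2 p.1) p.2) measurableT (mD c t).
  by rewrite setTI tailE.
- rewrite /tail !tailE.
  have permute s := independent_rows_permute s rowsZ (mD c t).
  exact: etrans (permute sigma) (esym (permute (fun=> 1%g))).
Qed.

Lemma measurable_coordinate_set (j : nat) (A : set S) :
  measurable A -> measurable [set x : seq_space S | A (x j)].
Proof. by move=> mA; apply: sub_sigma_algebra; exists j, A. Qed.

Lemma independent_sequence n (X : nat -> {RV P >-> S}) (A : 'I_n -> set S) :
  mutually_independent P X -> (forall i, measurable (A i)) ->
  P [set o | forall i : 'I_n, A i (X i o)] = (\prod_(i < n) P (X i @^-1` A i))%E.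
Proof.
move=> indX mA.
pose A' j : set S := if insub j is Some i then A i else setT.
have A'E (i : 'I_n) : A' i = A i by rewrite /A' valK.
have mA' j : measurable (A' j) by rewrite /A'; case: insubP.
have -> : [set o | forall i : 'I_n, A i (X i o)] =
    [set o | forall j, j \in index_iota 0 n -> A' j (X j o)].
  apply/seteqP; split=> [z Ao j|z Ao i]; last first.
    by rewrite -A'E; apply: Ao; rewrite mem_index_iota /=.
  by rewrite mem_index_iota => /= jn; have := Ao (Ordinal jn); rewrite -A'E.
rewrite (indX (index_iota 0 n) A')// ?iota_uniq// big_mkord.
by apply: eq_bigr => i _; rewrite A'E.
Qed.

(** Rectangles are read first as intersections of events on whole sequences, to
    use the independence of the copies, then as rectangles for one sequence. *)
Lemma independent_copies_rows n k (X : nat -> {RV P >-> S})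
    (Y : 'I_k -> nat -> {RV P >-> S}) :
  mutually_independent P X -> independent_copies P X Y ->
  independent_rows n Y (fun i A => P (X i @^-1` A)).
Proof.
move=> indX [indY sameY]; split=> [a i|A mA]; first exact: measurable_funPT.
pose E a := [set x : seq_space S | forall i : 'I_n, A a i (x i)].
have mE a : measurable (E a).
  rewrite (_ : E a = \bigcap_(i in [set: 'I_n]) [set x : seq_space S | A a i (x i)]).
    by apply: fin_bigcap_measurable => // i _; exact: measurable_coordinate_set.
  by apply/seteqP; split=> [x Ax i _|x Ax i]; exact: Ax.
have -> : [set o | forall a i, A a i (Y a i o)] =
    [set o | forall a, a \in index_enum 'I_k -> E a (as_random_sequence (Y a) o)].
  by apply/seteqP; split=> [z Ao a _ i|z Ao a i]; [exact: Ao|apply: Ao; rewrite mem_index_enum].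
rewrite (indY (index_enum 'I_k) E) ?index_enum_uniq//.
apply: eq_bigr => a _; rewrite sameY// -independent_sequence//.
Qed.

End IndependentRows.

Section AdditionalCopy.
Context (R : realType) d (Omega : measurableType d) (P : probability Omega R).
Context d' (S : measurableType d').

(** A new copy, numbered [ord0], is read on an independent second factor of the
    probability space. *)
Definition add_copy k (Y : 'I_k.+1 -> nat -> Omega -> S)
    (a : 'I_k.+2) (i : nat) (o : Omega * Omega) : S :=
  if unlift ord0 a is Some a' then Y a' i o.1 else Y ord0 i o.2.

Lemma independent_rows_add_copy n k (Y : 'I_k.+1 -> nat -> Omega -> S) mu :
  (forall i, mu i setT = 1%E) ->
  independent_rows P n Y mu -> independent_rows (P \x P)%E n (add_copy Y) mu.
Proof.
move=> mu1 [mY lawY]; split=> [a i|A mA].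
  rewrite /add_copy; case: unliftP => [a' _|_].
    exact: (measurableT_comp (mY a' i) measurable_fst).
  exact: (measurableT_comp (mY ord0 i) measurable_snd).
pose E := [set o | forall a i, A (lift ord0 a) i (Y a i o)].
pose A0 a i := if a == ord0 :> 'I_k.+1 then A ord0 i else setT.
pose E0 := [set o | forall a i, A0 a i (Y a i o)].
have mA0 a i : measurable (A0 a i) by rewrite /A0; case: ifP.
have mrows (A' : 'I_k.+1 -> 'I_n -> set S) : (forall a i, measurable (A' a i)) ->
    measurable [set o | forall a i, A' a i (Y a i o)].
  move=> mA'; rewrite (_ : [set o | _] = \bigcap_(p in [set: 'I_k.+1 * 'I_n])
    (Y p.1 p.2 @^-1` A' p.1 p.2)).
    apply: fin_bigcap_measurable => // p _.
    by rewrite -[X in measurable X]setTI; exact: mY.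
  by apply/seteqP; split=> [z Ao p _|z Ao a i]; [exact: Ao|exact: (Ao (a, i))].
have -> : [set o | forall a i, A a i (add_copy Y a i o)] = E `*` E0.
  apply/seteqP; split=> [z Ao|[z1 z2] [/= Eo E0o] a i].
    split=> a i.
      by have := Ao (lift ord0 a) i; rewrite /add_copy liftK.
    rewrite /A0; case: eqP => // ->.
    by have := Ao ord0 i; rewrite /add_copy unlift_none.
  rewrite /add_copy; case: unliftP => [a' ->|->]; first exact: Eo.
  by have := E0o ord0 i; rewrite /A0 eqxx.
transitivity (P E * P E0)%E.
  by apply: product_measure1E; [exact: (mrows (fun a => A (lift ord0 a)))|exact: (mrows A0)].
rewrite [in RHS]big_ord_recl muleC; congr (_ * _)%E.
  rewrite lawY// big_ord_recl /= [X in (_ * X)%E]big1 ?mule1// => a _.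
  by rewrite big1// => i _; rewrite /A0.
by apply: (lawY (fun a => A (lift ord0 a))) => a i.
Qed.

End AdditionalCopy.

Lemma probability_le_ae (R : realType) d (Omega : measurableType d)
    (P : probability Omega R) (A A' : set Omega) :
  measurable A -> measurable A' -> {ae P, forall o, A o -> A' o} -> (P A <= P A')%E.
Proof.
move=> mA mA' [N [mN PN AN]].
rewrite -(measureU0 mA' mN PN); apply: le_measure; rewrite ?inE//.
  exact: measurableU.
move=> o Ao; have [No|No] := pselect (N o); first by right.
by left; apply: contrapT => nA'; apply: No; apply: AN => /(_ Ao).
Qed.

Lemma measurable_neq (R : realType) (B : normedModType R) d (T : measurableType d)
    (f g : T -> B) :
  strongly_measurable f -> strongly_measurable g -> measurable [set x | f x <> g x].
Proof.
move=> mf mg; have mfg := strongly_measurableD mf (strongly_measurableZ (-1) mg).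
have := measurable_norm_strongly mfg measurableT (measurable_itv `]0, +oo[).
rewrite setTI; congr measurable; apply/seteqP; split=> x /=;
  rewrite in_itv /= andbT normr_gt0 scaleN1r subr_eq0.
  by move=> /eqP.
by move=> fg; apply/eqP.
Qed.

(** * Symmetric kernels *)

Section Symmetry.
Context (R : realType) d (Omega : measurableType d) (P : probability Omega R).
Context d' (S : measurableType d') (k n : nat).
Variables (X : nat -> {RV P >-> S}) (Y : 'I_k -> nat -> {RV P >-> S}) (j0 : 'I_k).
Hypotheses (indX : mutually_independent P X) (copies : independent_copies P X Y).

(** As the indices [i] are distinct, a permutation of the copies at each index
    replaces the copies prescribed by [w] by the single copy [j0], which has the
    law of [X]. *)
Lemma selection_same_law (i : k.-tuple 'I_n) (w : 'I_k -> 'I_k) (N : set (k.-tuple S)) :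
  uniq i -> measurable N ->
  P [set o | N [tuple Y (w l) (tnth i l) o | l < k]] =
  P [set o | N [tuple X (tnth i l) o | l < k]].
Proof.
move=> ui mN; have rows := independent_copies_rows n indX copies.
have [_ sameY] := copies.
pose E := [set x : seq_space S | N [tuple x (tnth i l) | l < k]].
have mE : measurable E.
  have mt : measurable_fun [set: seq_space S]
      (fun x : seq_space S => [tuple x (tnth i l) | l < k]).
    apply/measurable_fun_tnthP => l _ A mA; rewrite setTI.
    have := measurable_coordinate_set (tnth i l) mA; congr measurable.
    by apply/seteqP; split=> x /=; rewrite tnth_mktuple.
  by have := mt measurableT _ mN; rewrite setTI.
transitivity (P [set o | E (as_random_sequence (Y j0) o)]); last exact: (sameY j0 E mE).
pose E' := [set z : cfg ('I_k * 'I_n)%type S | N [tuple z (j0, tnth i l) | l < k]].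
have mE' : measurable E'.
  have mt : measurable_fun [set: cfg ('I_k * 'I_n)%type S]
      (fun z : cfg ('I_k * 'I_n)%type S => [tuple z (j0, tnth i l) | l < k]).
    apply/measurable_fun_tnthP => l.
    rewrite (_ : _ \o _ = fun x : cfg ('I_k * 'I_n)%type S => x (j0, tnth i l)).
      exact: measurable_coord.
    by apply/funext => x /=; rewrite tnth_mktuple.
  by have := mt measurableT _ mN; rewrite setTI.
(* at the index of position l, exchange the copies j0 and w l *)
pose sigma x : 'S_k := if [pick l | tnth i l == x] is Some l then tperm j0 (w l) else 1%g.
have sigmaE l : sigma (tnth i l) j0 = w l.
  rewrite /sigma; case: pickP => [l' /eqP /(tuple_uniqP _ ui) ->|/(_ l)].
    by rewrite tpermL.
  by rewrite eqxx.
have := independent_rows_permute sigma rows mE'; rewrite /E' /=.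
rewrite (_ : [set o | N [tuple Y (sigma (tnth i l) j0) (tnth i l) o | l < k]] =
    [set o | N [tuple Y (w l) (tnth i l) o | l < k]])//.
by apply/seteqP; split=> o; congr N; apply: eq_from_tnth => l;
  rewrite !tnth_mktuple sigmaE.
Qed.

Variables (B : normedModType R) (f : k.-tuple 'I_n -> k.-tuple S -> B).
Hypothesis mf : forall i : k.-tuple 'I_n, uniq i -> strongly_measurable (f i).
Hypothesis symf : forall (i : k.-tuple 'I_n) (p : 'S_k), uniq i ->
  {ae P, forall w, f i [tuple X (tnth i l) w | l < k] =
         f [tuple tnth i (p l) | l < k] [tuple X (tnth i (p l)) w | l < k]}.

Lemma uniq_permute (i : k.-tuple 'I_n) (p : 'S_k) :
  uniq [tuple tnth i (p l) | l < k] = uniq i.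
Proof.
apply/tuple_uniqP/tuple_uniqP => inj l l'; last first.
  by rewrite !tnth_mktuple => /inj /perm_inj.
move=> ll'; apply: (@perm_inj _ p^-1%g); apply: inj.
by rewrite !tnth_mktuple !permKV.
Qed.

(** The set of arguments on which symmetry fails is measurable, so that its
    probability depends on the law of the arguments only. *)
Lemma symmetry_transfer (i : k.-tuple 'I_n) (p : 'S_k) (w : 'I_k -> 'I_k) :
  uniq i ->
  {ae P, forall o, f i [tuple Y (w l) (tnth i l) o | l < k] =
     f [tuple tnth i (p l) | l < k] [tuple Y (w (p l)) (tnth i (p l)) o | l < k]}.
Proof.
move=> ui; pose h (y : k.-tuple S) := [tuple tnth y (p l) | l < k].
pose N := [set y : k.-tuple S | f i y <> f [tuple tnth i (p l) | l < k] (h y)].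
have mN : measurable N.
  apply: measurable_neq; first exact: mf.
  apply: (strongly_measurable_comp (f := f [tuple tnth i (p l) | l < k])).
    by apply: mf; rewrite uniq_permute.
  apply/measurable_fun_tnthP => l.
  rewrite (_ : _ \o _ = @tnth _ S ^~ (p l)); first exact: measurable_tnth.
  by apply/funext => y /=; rewrite tnth_mktuple.
have hE (g : 'I_k -> S) : h [tuple g l | l < k] = [tuple g (p l) | l < k].
  by apply: eq_from_tnth => l; rewrite !tnth_mktuple.
have tupmeas (V : 'I_k -> {RV P >-> S}) : measurable [set o | N [tuple V l o | l < k]].
  have mt : measurable_fun [set: Omega] (fun o => [tuple V l o | l < k]).
    apply/measurable_fun_tnthP => l.
    rewrite (_ : _ \o _ = V l); first exact: measurable_funPT.
    by apply/funext => y /=; rewrite tnth_mktuple.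
  by have := mt measurableT _ mN; rewrite setTI.
exists [set o | N [tuple Y (w l) (tnth i l) o | l < k]]; split.
- exact: (tupmeas (fun l => Y (w l) (tnth i l))).
- rewrite selection_same_law//; apply: measure_negligible.
    exact: (tupmeas (fun l => X (tnth i l))).
  by apply: negligibleS (symf p ui) => o; rewrite /N /= hE.
- by move=> o; rewrite /N /= hE.
Qed.

(** A word in which all of the [k] letters occur is a permutation, and symmetry
    together with a reindexing of the sum turns it into the identity. *)
Lemma decoupled_word_ae (w : {ffun 'I_k -> 'I_k}) : letters w = [set: 'I_k]%SET ->
  {ae P, forall o, comb (letter_array f Y) (single R w) (fun=> 1%g) o =
                   distinct_sum f (fun l i => Y l i o)}.
Proof.
move=> wT; have wi : injective w.
  have /imset_injP wi : #|(w @: [set: 'I_k])%SET| == #|[set: 'I_k]%SET|.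
    by rewrite -/(letters w) wT.
  by move=> l l'; apply: wi; rewrite inE.
pose q := (perm wi)^-1%g.
have wq l : w (q l) = l by rewrite -[w _](permE wi) permKV.
have : {ae P, forall o, forall i : k.-tuple 'I_n, uniq i ->
   f i [tuple Y (w l) (tnth i l) o | l < k] =
   f [tuple tnth i (q l) | l < k] [tuple Y (w (q l)) (tnth i (q l)) o | l < k]}.
  apply: filter_forall => i; have [ui|ui] := boolP (uniq i); last exact: aeW.
  by apply: filterS (symmetry_transfer q w ui) => o.
apply: filterS => o fo; rewrite comb_single /distinct_sum.
pose perm_i (p : 'S_k) (i : k.-tuple 'I_n) := [tuple tnth i (p l) | l < k].
have perm_iK p : cancel (perm_i p) (perm_i p^-1%g).
  by move=> i; apply: eq_from_tnth => l; rewrite !tnth_mktuple permKV.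
rewrite [RHS](reindex (perm_i q)) /=; last first.
  exists (perm_i q^-1%g) => i _; first exact: perm_iK.
  by have := perm_iK q^-1%g i; rewrite invgK.
apply: eq_big => [i|i ui]; first by rewrite uniq_permute.
rewrite /letter_array relabel1 fo//; congr (f _ _).
by apply: eq_from_tnth => l; rewrite !tnth_mktuple wq.
Qed.

End Symmetry.

(** * Decoupling of tail probabilities *)

Theorem theorem1 (R : realType) (k : nat) (hk : (2 <= k)%N) :
  exists C C' : R, 0 < C /\ 0 < C' /\
  forall (d : measure_display) (Omega : measurableType d)
    (P : probability Omega R)
    (d' : measure_display) (S : measurableType d')
    (X : nat -> {RV P >-> S}) (Y : 'I_k -> nat -> {RV P >-> S})
    (B : completeNormedModType R) (n : nat)
    (f : k.-tuple 'I_n -> k.-tuple S -> B),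
  mutually_independent P X ->
  independent_copies P X Y ->
  (k <= n)%N ->
  (forall i : k.-tuple 'I_n, uniq i -> strongly_measurable (f i)) ->
  let j1 : 'I_k := Ordinal (ltnW hk) in
  let coupled w := distinct_sum f (fun _ i => Y j1 i w) in
  let decoupled w := distinct_sum f (fun l i => Y l i w) in
  (forall t : R, 0 < t ->
     (P [set w | (t <= `|coupled w|)%R] <=
        C%:E * P [set w | (t <= C * `|decoupled w|)%R])%E) /\
  ((forall (i : k.-tuple 'I_n) (p : 'S_k), uniq i ->
      {ae P, forall w,
         f i [tuple X (tnth i l) w | l < k] =
         f [tuple tnth i (p l) | l < k]
           [tuple X (tnth i (p l)) w | l < k]}) ->
   forall t : R, 0 < t ->
     (P [set w | (t <= `|decoupled w|)%R] <=
        C'%:E * P [set w | (t <= C' * `|coupled w|)%R])%E).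
Proof.
case: k hk => [//|k] hk; set j0 : 'I_k.+1 := Ordinal (ltnW hk).
pose spread : {ffun 'I_k.+1 -> 'I_k.+2} := [ffun l => lift ord0 l].
have spread_inj : injective spread by move=> l l'; rewrite !ffunE => /lift_inj.
have [C C0 domC] :=
  dominated_by_injective R (const_word k.+1 (lift ord0 j0)) (ltnSn k.+1) spread_inj.
have [C' C'0 domC'] := sum_words_with_dominated R j0 [set: 'I_k.+1]%SET (ltn0Sn k).
exists C, C'; split=> //; split=> //.
move=> d Omega P d' S X Y B n f indX copies _ mf /=; rewrite -/j0.
have rows := independent_copies_rows n indX copies.
have combE d2 (T : measurableType d2) K (Z : 'I_K -> nat -> T -> S) w o :
    comb (letter_array f Z) (single R w) (fun=> 1%g) o =
    distinct_sum f (fun l i => Z (w l) i o).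
  by rewrite comb_single; apply: eq_bigr => i _; rewrite relabel1.
have exchY := exchangeable_letter_array rows mf.
have mtail (w : {ffun 'I_k.+1 -> 'I_k.+1}) s :
    measurable [set o | s <= `|distinct_sum f (fun l i => Y (w l) i o)| ].
  have := exch_measurable exchY (single R w) (fun=> 1%g) s; congr measurable.
  by apply/seteqP; split=> o /=; rewrite combE.
have coupledE o : distinct_sum f (fun l i => Y (const_word k.+1 j0 l) i o) =
    distinct_sum f (fun _ i => Y j0 i o).
  by congr distinct_sum; apply/funext => l; rewrite ffunE.
pose id_word : {ffun 'I_k.+1 -> 'I_k.+1} := [ffun l => l].
have decoupledE o : distinct_sum f (fun l i => Y (id_word l) i o) =
    distinct_sum f (fun l i => Y l i o).
  by congr distinct_sum; apply/funext => l; rewrite ffunE.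
split=> [t t0|symf t t0].
- pose Z := add_copy Y.
  have rowsZ : independent_rows (P \x P)%E n Z (fun i A => P (X i @^-1` A)).
    apply: independent_rows_add_copy rows => i.
    by rewrite preimage_setT probability_setT.
  have exchZ := exchangeable_letter_array rowsZ mf.
  (* words in the letters of the first factor do not see the added copy *)
  have tailE (w : {ffun 'I_k.+1 -> 'I_k.+1}) s :
     tail (P \x P)%E (letter_array f Z) (single R [ffun l => lift ord0 (w l)])
       (fun=> 1%g) s =
     P [set o | s <= `|distinct_sum f (fun l i => Y (w l) i o)| ].
    have := mtail w s; set D := (X in measurable X) => mD.
    rewrite /tail (_ : [set o | _] = D `*` setT).
      transitivity (P D * P setT)%E; first exact: product_measure1E.
      by rewrite probability_setT mule1.
    have E z : comb (letter_array f Z) (single R [ffun l => lift ord0 (w l)])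
        (fun=> 1%g) z = distinct_sum f (fun l i => Y (w l) i z.1).
      rewrite combE; congr distinct_sum; apply/funext => l; apply/funext => i.
      by rewrite ffunE /Z /add_copy liftK.
    by apply/seteqP; split=> [z /=|z [/=]]; rewrite E.
  have := domC _ _ _ _ _ _ exchZ t t0.
  have -> : spread = [ffun l => lift ord0 (id_word l)].
    by apply/ffunP => l; rewrite !ffunE.
  have -> : const_word k.+1 (lift ord0 j0) = [ffun l => lift ord0 (const_word k.+1 j0 l)].
    by apply/ffunP => l; rewrite !ffunE.
  rewrite !tailE; congr (_ <= _ * _)%E; congr (P _); apply/seteqP.
    by split=> o /=; rewrite coupledE.
  by split=> o /=; rewrite decoupledE ler_pdivrMr// mulrC.
- pose c := \sum_(w : {ffun 'I_k.+1 -> 'I_k.+1} | letters w == [set: 'I_k.+1]%SET) single R w.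
  (* m is the number k! of words in which all letters occur *)
  have ae_c : {ae P, forall o, exists2 m : nat, (0 < m)%N &
      comb (letter_array f Y) c (fun=> 1%g) o = distinct_sum f (fun l i => Y l i o) *+ m}.
    have : {ae P, forall o, forall w : {ffun 'I_k.+1 -> 'I_k.+1},
       letters w = [set: 'I_k.+1]%SET ->
       comb (letter_array f Y) (single R w) (fun=> 1%g) o =
       distinct_sum f (fun l i => Y l i o)}.
      apply: filter_forall => w; have [wT|wT] := pselect (letters w = [set: 'I_k.+1]%SET).
        by apply: filterS (decoupled_word_ae j0 indX copies mf symf wT) => o.
      exact: aeW.
    apply: filterS => o words.
    exists #|[pred w : {ffun 'I_k.+1 -> 'I_k.+1} | letters w == [set: 'I_k.+1]%SET]|.
      apply/card_gt0P; exists id_word; rewrite inE; apply/eqP/setP => l.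
      by rewrite [RHS]inE; apply/lettersP; exists l; rewrite ffunE.
    rewrite (_ : comb _ _ _ _ = \sum_(w : {ffun 'I_k.+1 -> 'I_k.+1} |
        letters w == [set: 'I_k.+1]%SET)
        comb (letter_array f Y) (single R w) (fun=> 1%g) o).
      by rewrite -sumr_const; apply: eq_bigr => w /eqP; exact: words.
    rewrite /c; elim/big_rec2: _ => [|w x y _ <-]; first exact: comb0.
    exact: combD.
  apply: (@le_trans _ _ (tail P (letter_array f Y) c (fun=> 1%g) t)).
    apply: probability_le_ae.
    - have := mtail id_word t; congr measurable.
      by apply/seteqP; split=> o /=; rewrite decoupledE.
    - exact: (exch_measurable exchY).
    - apply: filterS ae_c => o [m m0 cE] /=; rewrite cE => /le_trans; apply.
      by rewrite normrMn -[leRHS]mulr_natr ler_peMr ?ler1n.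
  have := domC' _ _ _ _ _ _ exchY t t0; congr (_ <= _ * _)%E.
  congr (P _); apply/seteqP; split=> o /=;
    by rewrite combE coupledE ler_pdivrMr// mulrC.
Qed.
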